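(* Let $\Phi$ be the standard normal distribution function. (1) Let $B_1,\ldots,B_n$ be i.i.d. Bernoulli variables with success probability $p\in(0,1)$, $q=1-p$, and $X_i=(B_i-p)/\sqrt{pq}$. Then for the distribution function $F$ of $W=n^{-1/2}\sum_{i=1}^nX_i$ (the standardized binomial $\mathcal{B}(n,p)$ distribution), for every $n=1,2,\ldots$, $$\|F-\Phi\|_1\le\frac{p^2+q^2}{\sqrt{npq}}=\frac{E|X_1|^3}{\sqrt n}.$$ (2) For $F$ the distribution function of $W=n^{-1/2}\sum_{i=1}^nU_i$, where $U_1,\ldots,U_n$ are i.i.d. with the mean zero, variance $1$ uniform distribution $\mathcal{U}[-\sqrt3,\sqrt3]$, for every $n=1,2,\ldots$, $$\|F-\Phi\|_1\le\frac{\sqrt3}{4\sqrt n}=\frac{E|U_1|^3}{3\sqrt n}.$$ (3) If $X$ is any mean zero, variance $\sigma_1^2$ random variable with distribution function $G$, and $Z$ has the $\mathcal{N}(0,\sigma_2^2)$ distribution and is independent of $X$, then when $\sigma_1^2+\sigma_2^2=1$ the distribution function $F$ of the variance $1$ sum $W=X+Z$ satisfies $$\|F-\Phi\|_1\le2\sigma_1^2\|G^*-G\|_1,$$ where $G^*$ is the distribution function of a variable $X^*$ having the $X$-zero biased distribution.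
   Context: For distribution functions $F,G$ on $\mathbf{R}$, $\|F-G\|_1=\int_{-\infty}^\infty|F(t)-G(t)|\,dt$. Zero biased distribution: for a mean zero random variable $W$ with finite variance $\sigma^2$, a random variable $W^*$ has the $W$-zero biased distribution if $E[Wf(W)]=\sigma^2E[f'(W^* )]$ for all absolutely continuous $f$ with $E|Wf(W)|<\infty$ and $E|f'(W^* )|<\infty$. Such a $W^*$ exists for every such $W$; for $\sigma^2>0$ its distribution is uniquely determined and has density $x\mapsto-\sigma^{-2}E[W\mathbf{1}(W\le x)]$. *)

(* Defs.v *)
From HB Require Import structures.
From mathcomp Require Import all_boot all_order all_algebra.
From mathcomp Require Import all_classical all_reals all_analysis.

Set Implicit Arguments.
Unset Strict Implicit.
Unset Printing Implicit Defensive.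

Import Order.TTheory GRing.Theory Num.Theory.
Import numFieldNormedType.Exports.

Local Open Scope classical_set_scope.
Local Open Scope ring_scope.

Definition has_law d d' (T : measurableType d) (T' : measurableType d')
    (R : realType) (P : probability T R) (X : {RV P >-> T'})
    (mu : set T' -> \bar R) : Prop :=
  forall A : set T', measurable A -> distribution P X A = mu A.

Definition mutually_independent d d' (T : measurableType d)
    (T' : measurableType d') (R : realType) (P : probability T R)
    (I : finType) (X : I -> {RV P >-> T'}) : Prop :=
  forall (J : {set I}) (A : I -> set T'), (forall i, measurable (A i)) ->
    P (\bigcap_(i in [set` J]) X i @^-1` A i) =
    (\prod_(i in J) P (X i @^-1` A i))%E.

Definition independent2 d d' (T : measurableType d) (T' : measurableType d')
    (R : realType) (P : probability T R) (X Y : {RV P >-> T'}) : Prop :=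
  forall A B : set T', measurable A -> measurable B ->
    P (X @^-1` A `&` Y @^-1` B) = (P (X @^-1` A) * P (Y @^-1` B))%E.

(* The library's Bernoulli probability lives on bool; this is its image on
   the real line, false |-> 0 and true |-> 1. *)
Definition bernoulli_law (R : realType) (p : R) : set R -> \bar R :=
  fun A => bernoulli_prob p ((fun b : bool => b%:R) @^-1` A).

(* normal_prob m 0 is the uniform law on [0, 1] in the library; N(m, 0) is the point mass
   at m. The parameter s is the standard deviation. *)
Definition gaussian_law (R : realType) (m s : R) : set R -> \bar R :=
  fun A => if s == 0 then \d_m A else normal_prob m s A.

Definition Phi (R : realType) (t : R) : \bar R := normal_prob 0 1 `]-oo, t].

Definition L1dist (R : realType) (F G : R -> \bar R) : \bar R :=
  (\int[lebesgue_measure]_t `|F t - G t|)%E.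

Lemma ltN_sqrt3 (R : realType) : - Num.sqrt 3 < Num.sqrt 3 :> R.
Proof. by rewrite gtrN// sqrtr_gt0. Qed.

Definition abs_continuous_on (R : realType) (a b : R) (f : R -> R) : Prop :=
  forall e : R, 0 < e -> exists2 d : R, 0 < d &
    forall (n : nat) (u v : 'I_n -> R),
      (forall i, a <= u i /\ u i <= v i /\ v i <= b) ->
      trivIset setT (fun i : 'I_n => `]u i, v i[%classic) ->
      \sum_(i < n) (v i - u i) < d ->
      \sum_(i < n) `|f (v i) - f (u i)| < e.

(* On the whole line, absolute continuity is understood on every compact
   interval. *)
Definition abs_continuous (R : realType) (f : R -> R) : Prop :=
  forall a b : R, abs_continuous_on a b f.

(* An absolutely continuous f is differentiable almost everywhere only; f^`()
   is 0 at the points where f is not differentiable. The variable Ws may live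
   on another probability space than W. *)
Definition zero_biased (R : realType)
    d (T : measurableType d) (P : probability T R) (W : {RV P >-> R})
    d' (T' : measurableType d') (P' : probability T' R) (Ws : {RV P' >-> R})
    : Prop :=
  forall f : R -> R, abs_continuous f ->
    P.-integrable setT (fun w => (W w * f (W w))%:E) ->
    P'.-integrable setT (fun w => (f^`()%classic (Ws w))%:E) ->
    ('E_P[(fun w => W w * f (W w))%R] =
     'V_P[W] * 'E_P'[(fun w => f^`()%classic (Ws w))%R])%E.

(* Main.v *)
(** Write [phi], [Phi] for the standard normal density and distribution function,
    [F] for the distribution function of [W], and set
    [bias_defect P X s t = s P(X <= t) + E[X (t - X)^+]]. When [Var X = s] this is
    [s (G t - Gs t)], where [G] and [Gs] are the distribution functions of [X] and
    of its zero biased version.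

    Stein's equation for the half-line indicator of [t], integrated against [F],
    reads [Phi t - F t = int H(t,x) r(x) dx - r(t)] with [r = bias_defect W 1] and
    a kernel [H >= 0] (the regular part of the second derivative of the Stein
    solution, built from the Mills ratio [(1 - Phi) / phi]). Since
    [int H(t,x) dt = 1], this gives [||F - Phi||_1 <= 2 ||r||_1].

    If [W = sum_i X_i] with [X_i] independent of [W - X_i] and [sum_i s_i = 1],
    then [r(x) = sum_i E (bias_defect X_i s_i (x - (W - X_i)))], so
    [||r||_1 <= sum_i ||bias_defect X_i s_i||_1]. The defect of a centered
    Gaussian variable vanishes and those of a Bernoulli and of a uniform variable
    are explicit. *)
Require Import Defs.
From HB Require Import structures.
From mathcomp Require Import all_boot all_order all_algebra.
From mathcomp Require Import all_classical all_reals all_analysis.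
From mathcomp Require Import measurable_realfun ring lra.

Set Implicit Arguments.
Unset Strict Implicit.
Unset Printing Implicit Defensive.

Import Order.TTheory GRing.Theory Num.Theory.
Import numFieldNormedType.Exports.

Local Open Scope classical_set_scope.
Local Open Scope ring_scope.

(** * Improper integrals and the normal tail *)

(** For the threshold [t], the derivative of the Stein solution [f] has a jump of size -1 at [t], so
    as a measure [f'' = H(t, .) - delta_t]. Since [f] and [f'] vanish at +oo, both are recovered
    from it: [f'(w)] is minus the mass of [f''] on x >= w, and [f(w)] is the integral of [x - w]
    against [f''] there. Substituted in [f'(w) - w f(w) = 1(w <= t) - Phi t], these leave [f'']
    tested against [1(w <= x) (1 + w (x - w))], whose mean over [w] is [r(x)]. The atom is the
    origin of the separate term [r(t)], and the atom and the regular part contribute one unit each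
    to the factor 2.

    The nonnegativity of [H] is the convexity of the Mills ratio. The identity is checked for each
    fixed [w] with explicit primitives, so the law of [W] enters only through an exchange of
    integrals, for which second moments suffice.

    The defect is a functional of the law of [X] alone. A sum of independent variables therefore
    calls for no coupling with a zero biased variable: additivity is an identity under the integral
    sign. *)

Section improper_ftc.
Context {R : realType}.
Let mu := @lebesgue_measure R.

Lemma is_derive_continuous (F : R -> R) (x l : R) : is_derive x 1 F l -> {for x, continuous F}.
Proof. by move=> h; apply/differentiable_continuous/derivable1_diffP; case: h. Qed.

Lemma ge0_integral_primitive_y (f F : R -> R) a l :
  (forall x, a <= x -> 0 <= f x) -> continuous f ->
  (forall x, is_derive x (1:R) F (f x)) -> F x @[x --> +oo%R] --> l ->
  (\int[mu]_(x in `[a, +oo[) (f x)%:E = (l - F a)%:E)%E.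
Proof.
move=> f0 cf dF Fl; rewrite (@ge0_continuous_FTC2y _ f F a l)//.
- exact: continuous_subspaceT.
- exact: cvg_at_right_filter (is_derive_continuous (dF a)).
- by move=> x _; rewrite derive1E; case: (dF x).
Qed.

(** The increment of [F] from [a] to infinity is the integral of a nonnegative function. This turns
    the sign of a derivative into a tail inequality. *)
Lemma le_primitive_y (f F : R -> R) a l :
  (forall x, a <= x -> 0 <= f x) -> continuous f ->
  (forall x, is_derive x (1:R) F (f x)) -> F x @[x --> +oo%R] --> l -> F a <= l.
Proof.
move=> f0 cf dF Fl; rewrite -subr_ge0 -lee_fin.
rewrite -(ge0_integral_primitive_y f0 cf dF Fl); apply: integral_ge0 => x.
by rewrite /= in_itv/= andbT lee_fin => /f0.
Qed.

Lemma cvg_mully0 (c : R) (f : R -> R) : f x @[x --> +oo%R] --> (0 : R) ->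
  (c * f x) @[x --> +oo%R] --> (0 : R).
Proof. by move=> f0; rewrite -[X in _ --> X](mulr0 c); exact: cvgMl_tmp. Qed.

Lemma cvg_oppy0 (f : R -> R) : f x @[x --> +oo%R] --> (0 : R) ->
  (- f x) @[x --> +oo%R] --> (0 : R).
Proof. by move=> f0; rewrite -[X in _ --> X]oppr0; exact: cvgN. Qed.

Lemma cvgy0_le_div (C : R) (f : R -> R) :
  (forall x, 1 <= x -> `|f x| <= C / x) -> f x @[x --> +oo%R] --> (0 : R).
Proof.
move=> fC.
have Cx : (C * x^-1) @[x --> +oo%R] --> (0 : R).
  apply: cvg_mully0.
  apply/gtr0_cvgV0; last exact: cvg_id.
  exact: nbhs_pinfty_gt.
apply/norm_cvg0P.
apply: (@squeeze_cvgr _ _ _ _ (cst 0) (fun x => C * x^-1)) => //; last exact: cvg_cst.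
near=> x; rewrite normr_ge0 fC//.
Unshelve. all: by end_near. Qed.

End improper_ftc.

Section normal_tail.
Context {R : realType} (s : R) (s0 : s != 0).
Let mu := @lebesgue_measure R.
Local Notation phi := (normal_pdf 0 s).

Definition normal_tail (x : R) : R := \int[mu]_(y in `[x, +oo[) phi y.
Local Notation Q := normal_tail.

Let s2_gt0 : 0 < s ^+ 2. Proof. by rewrite exprn_even_gt0. Qed.

Lemma normal_pdf_gt0 x : 0 < phi x.
Proof. by rewrite normal_pdfE// mulr_gt0 ?normal_peak_gt0 ?expR_gt0. Qed.

Lemma normal_pdfN x : phi (- x) = phi x.
Proof. by rewrite !normal_pdfE// /normal_fun !subr0 sqrrN. Qed.

Lemma is_derive_normal_pdf (x : R) :
  is_derive x (1 : R) phi (- (x / s ^+ 2) * phi x).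
Proof.
rewrite normal_pdfE// /normal_fun.
apply: is_derive_eq.
rewrite /GRing.scale/= !subr0.
field.
by rewrite s0.
Qed.

(** With [u = x ^+ 2 / (2 * s ^+ 2)], [exp u >= 1 + u >= u] gives [exp (- u) <= 1 / u]. This power
    decay is all that the limits at infinity use. *)
Lemma normal_pdf_le (x : R) : 0 < x -> phi x <= 2 * s ^+ 2 * normal_peak s / x ^+ 2.
Proof.
move=> x0; rewrite normal_pdfE// /normal_fun subr0.
set u := x ^+ 2 / (s ^+ 2 *+ 2).
have u0 : 0 < u by rewrite divr_gt0 ?exprn_gt0// pmulrn_lgt0.
rewrite mulNr -/u expRN.
have -> : 2 * s ^+ 2 * normal_peak s / x ^+ 2 = normal_peak s * u^-1.
  by rewrite /u -mulr_natr; field; rewrite s0 gt_eqF.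
rewrite ler_pM2l ?normal_peak_gt0// lef_pV2 ?posrE ?expR_gt0//.
by rewrite (le_trans _ (expR_ge1Dx _))// lerDr.
Qed.

Lemma cvg_normal_pdfMy : (fun x => x * phi x) x @[x --> +oo%R] --> (0 : R).
Proof.
apply: (@cvgy0_le_div _ (2 * s ^+ 2 * normal_peak s)) => x x1.
have x0 : 0 < x by exact: lt_le_trans x1.
rewrite ger0_norm ?mulr_ge0 ?normal_pdf_ge0 ?(ltW x0)//.
have /le_trans := ler_wpM2l (ltW x0) (normal_pdf_le x0); apply.
by rewrite le_eqVlt; apply/orP; left; apply/eqP; field; rewrite gt_eqF.
Qed.

Lemma cvg_normal_pdfy : phi x @[x --> +oo%R] --> (0 : R).
Proof.
apply: (@cvgy0_le_div _ (2 * s ^+ 2 * normal_peak s)) => x x1.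
have x0 : 0 < x by exact: lt_le_trans x1.
rewrite ger0_norm ?normal_pdf_ge0//.
have C0 : 0 < 2 * s ^+ 2 * normal_peak s.
  by rewrite (mulr_gt0 (mulr_gt0 _ s2_gt0)) ?normal_peak_gt0.
rewrite (le_trans (normal_pdf_le x0))// ler_pM2l//.
by rewrite lef_pV2 ?posrE ?exprn_gt0//; exact: ler_eXnr.
Qed.

Lemma measurable_normal_pdf_EFin (D : set R) : measurable_fun D (EFin \o phi).
Proof. by apply: measurable_funTS; apply/measurable_EFinP; exact: measurable_normal_pdf. Qed.

Lemma integrable_normal_pdf_sub D : measurable D -> mu.-integrable D (EFin \o phi).
Proof. by move=> mD; apply: (integrableS measurableT) => //; exact: integrable_normal_pdf. Qed.

Lemma normal_tailE x : (\int[mu]_(y in `[x, +oo[) (phi y)%:E = (Q x)%:E)%E.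
Proof. by rewrite fineK// integrable_fin_num//; exact: integrable_normal_pdf_sub. Qed.

Lemma normal_tail_ge0 x : 0 <= Q x.
Proof. by apply: fine_ge0; apply: integral_ge0 => y _; rewrite lee_fin normal_pdf_ge0. Qed.

Lemma normal_tailNE x : (\int[mu]_(y in `]-oo, x]) (phi y)%:E = (Q (- x))%:E)%E.
Proof.
rewrite -{1}(opprK x) ge0_integration_by_substitutionNy.
- rewrite -normal_tailE; apply: eq_integral => y _ /=.
  by rewrite normal_pdfN.
- by apply: continuous_subspaceT; exact: continuous_normal_pdf.
- by move=> y _; exact: normal_pdf_ge0.
Qed.

Lemma normal_tailN x : Q (- x) = 1 - Q x.
Proof.
apply/EFin_inj; rewrite EFinB -normal_tailNE -(integral_normal_pdf 0 s).
rewrite -(setUv `]-oo, x]%classic) integral_setU_EFin//=.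
- rewrite setCitvl integral_itv_obnd_cbnd; last exact: measurable_normal_pdf_EFin.
  by rewrite normal_tailE addeK.
- exact: measurableC.
- by apply: measurable_funTS; exact: measurable_normal_pdf.
- by apply/disj_set2P; rewrite setICr.
Qed.

Lemma is_derive_normal_tail (x : R) : is_derive x (1 : R) Q (- phi x).
Proof.
(* The fundamental theorem differentiates in the upper endpoint, so the tail is first expressed by
   an integral over []-oo, x]]. *)
have -> : Q = fun x => 1 - Q (- x) by apply/funext => y; rewrite normal_tailN opprB addrC subrK.
have QE : (fun x => 1 - Q (- x)) = fun x => 1 - \int[mu]_(y in `]-oo, x]) phi y.
  by apply/funext => y; rewrite /Rintegral normal_tailNE.
rewrite QE.
have [dF F'] := @continuous_FTC1 R phi -oo%O x (x + 1) ltac:(by rewrite ltrDl)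
  (integrable_normal_pdf_sub (measurable_itv _)) (ltNyr _) (@continuous_normal_pdf R 0 s s0 x).
have : is_derive x (1:R) (fun x => \int[mu]_(y in `]-oo, x]) phi y) (phi x).
  by split => //; rewrite -F' derive1E.
move=> h; rewrite -[- phi x]add0r; exact: is_deriveB.
Qed.

Lemma continuous_normal_pdf0 : continuous phi. Proof. exact: continuous_normal_pdf. Qed.
Lemma continuous_normal_tail : continuous Q.
Proof. by move=> x; apply: (is_derive_continuous (is_derive_normal_tail x)). Qed.

(** On [[x, +oo[] the factor [x] is at most [y], and [y * phi y] has the primitive
    [- (s ^+ 2 * phi y)]. *)
Lemma mul_normal_tail_le x : 0 <= x -> x * Q x <= s ^+ 2 * phi x.
Proof.
move=> x0; rewrite -lee_fin EFinM -normal_tailE -ge0_integralZl//; last 2 first.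
- exact: measurable_normal_pdf_EFin.
- by move=> y _; rewrite lee_fin normal_pdf_ge0.
have dF (y : R) : is_derive y (1 : R) (fun y => - (s ^+ 2 * phi y)) (y * phi y).
  have h := is_derive_normal_pdf y.
  apply: is_derive_eq; rewrite /GRing.scale/=; field.
  by rewrite s0.
have -> : (s ^+ 2 * phi x)%:E = (\int[mu]_(y in `[x, +oo[) (y * phi y)%:E)%E.
  rewrite (@ge0_integral_primitive_y R _ (fun y => - (s ^+ 2 * phi y)) x 0)//.
  - by rewrite sub0r opprK.
  - by move=> y xy; rewrite mulr_ge0 ?normal_pdf_ge0// (le_trans x0).
  - by move=> y; apply: cvgM => //; exact: continuous_normal_pdf0.
  - by apply: cvg_oppy0; apply: cvg_mully0; exact: cvg_normal_pdfy.
apply: ge0_le_integral => //.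
- by move=> y _; rewrite -EFinM lee_fin mulr_ge0 ?normal_pdf_ge0.
- by apply: emeasurable_funM => //; exact: measurable_normal_pdf_EFin.
- apply/measurable_EFinP; apply: measurable_funM => //.
  by apply/measurable_EFinP; exact: measurable_normal_pdf_EFin.
- by move=> y; rewrite /= in_itv/= andbT => xy; rewrite -EFinM lee_fin ler_wpM2r ?normal_pdf_ge0.
Qed.

Lemma cvg_normal_tailMy : (fun x => x * Q x) x @[x --> +oo%R] --> (0 : R).
Proof.
apply: (@squeeze_cvgr _ _ _ _ (cst 0) (fun x => s ^+ 2 * phi x)); last 2 first.
- exact: cvg_cst.
- by apply: cvg_mully0; exact: cvg_normal_pdfy.
near=> x; have x0 : 0 <= x by near: x; apply: nbhs_pinfty_ge; exact: num_real.
by rewrite mulr_ge0 ?normal_tail_ge0//= mul_normal_tail_le.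
Unshelve. all: by end_near. Qed.

Lemma cvg_normal_tailMMy : (fun x => x ^+ 2 * Q x) x @[x --> +oo%R] --> (0 : R).
Proof.
apply: (@squeeze_cvgr _ _ _ _ (cst 0) (fun x => s ^+ 2 * (x * phi x))); last 2 first.
- exact: cvg_cst.
- by apply: cvg_mully0; exact: cvg_normal_pdfMy.
near=> x; have x0 : 0 <= x by near: x; apply: nbhs_pinfty_ge; exact: num_real.
rewrite mulr_ge0 ?normal_tail_ge0 ?exprn_ge0//= expr2 -mulrA mulrCA [leRHS]mulrCA.
by rewrite ler_wpM2l// mul_normal_tail_le.
Unshelve. all: by end_near. Qed.

Lemma cvg_normal_taily : Q x @[x --> +oo%R] --> (0 : R).
Proof.
apply: (@squeeze_cvgr _ _ _ _ (cst 0) (fun x => x * Q x)); last 2 first.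
- exact: cvg_cst.
- exact: cvg_normal_tailMy.
near=> x; have x1 : 1 <= x by near: x; apply: nbhs_pinfty_ge; exact: num_real.
by rewrite normal_tail_ge0/= ler_peMl ?normal_tail_ge0.
Unshelve. all: by end_near. Qed.

End normal_tail.

(** * The Stein kernel *)

Section piecewise_integral.
Context {R : realType}.
Let mu := @lebesgue_measure R.
Variables (t : R) (f1 f2 F1 F2 : R -> R) (l : R).
Hypotheses (cf1 : continuous f1) (cf2 : continuous f2).
Hypotheses (dF1 : forall x, is_derive x (1 : R) F1 (f1 x))
  (dF2 : forall x, is_derive x (1 : R) F2 (f2 x)).
Hypothesis F1l : F1 x @[x --> +oo%R] --> l.

Lemma integral_ifr_y w : t <= w -> (forall x, w <= x -> 0 <= f1 x) ->
  (\int[mu]_(x in `[w, +oo[) (if t < x then f1 x else f2 x)%:E = (l - F1 w)%:E)%E.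
Proof.
move=> tw f10; rewrite -(ge0_integral_primitive_y f10 cf1 dF1 F1l).
have mif : measurable_fun [set: R] (fun x => (if t < x then f1 x else f2 x)).
  apply: measurable_fun_ifT; first exact: measurable_fun_ltr.
  - exact: continuous_measurable_fun.
  - exact: continuous_measurable_fun.
(* When [w = t] the integrand at the endpoint is [f2 t]; opening the interval removes this point. *)
rewrite -!integral_itv_obnd_cbnd; last 2 first.
- apply/measurable_EFinP; apply: measurable_funTS; exact: continuous_measurable_fun.
- by apply/measurable_EFinP; apply: measurable_funTS.
apply: eq_integral => x; rewrite inE/= in_itv/= andbT => wx.
by rewrite (le_lt_trans tw wx).
Qed.

Lemma integral_if_y w : w < t -> (forall x, t <= x -> 0 <= f1 x) ->
  (forall x, w <= x -> 0 <= f2 x) ->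
  (\int[mu]_(x in `[w, +oo[) (if t < x then f1 x else f2 x)%:E =
    (F2 t - F2 w + (l - F1 t))%:E)%E.
Proof.
move=> wt f10 f20.
have mif : measurable_fun [set: R] (fun x => (if t < x then f1 x else f2 x)).
  apply: measurable_fun_ifT; first exact: measurable_fun_ltr.
  - exact: continuous_measurable_fun.
  - exact: continuous_measurable_fun.
rewrite (@itv_bndbnd_setU _ _ _ (BRight t)) ?bnd_simp ?ltW//.
rewrite ge0_integral_setU//; last 3 first.
- by apply/measurable_EFinP; apply: measurable_funTS.
- move=> x /= H; rewrite lee_fin; case: ifPn => [/ltW/f10//|_].
  case: H; rewrite /= in_itv/= => /andP[wx _]; first exact: f20.
  by apply: f20; rewrite ltW// (lt_trans wt).
- apply/disj_set2P; apply/seteqP; split => x //=; rewrite !in_itv/= andbT.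
  by move=> [/andP[_ xt] tx]; move: (le_lt_trans xt tx); rewrite ltxx.
rewrite EFinD; congr (_ + _)%E.
- rewrite EFinB -(@continuous_FTC2 R f2 F2)//.
  + by apply: eq_integral => x; rewrite inE/= in_itv/= => /andP[_ xt]; rewrite ltNge xt.
  + exact: continuous_subspaceT.
  + split.
    * by move=> x _; have [] := dF2 x.
    * exact: cvg_at_right_filter (is_derive_continuous (dF2 w)).
    * exact: cvg_at_left_filter (is_derive_continuous (dF2 t)).
  + by move=> x _; rewrite derive1E; have [] := dF2 x.
- rewrite integral_itv_obnd_cbnd; last by apply/measurable_EFinP; apply: measurable_funTS.
  exact: integral_ifr_y.
Qed.

End piecewise_integral.

Section stein_kernel.
Context {R : realType}.
Let mu := @lebesgue_measure R.
Local Notation phi := (normal_pdf 0 1 : R -> R).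
Local Notation Q := (normal_tail 1 : R -> R).
Let n10 : (1 : R) != 0. Proof. exact: oner_neq0. Qed.
Local Hint Resolve n10 : core.

Definition mills (x : R) : R := Q x / phi x.
(** This is [E (N - x)^+] for a standard normal [N], that is, the integral of [Q] over [[x,
    +oo[]. *)
Definition tail_int (x : R) : R := phi x - x * Q x.
(** The second derivative of [mills], by two uses of [mills' = x * mills - 1]. *)
Definition mills2 (x : R) : R := x * (x * mills x - 1) + mills x.
(* The Stein solution for the indicator of [`]-oo, t]] is [Phi t * mills x] for
   [x > t] and [(1 - Phi t) * mills (- x)] for [x <= t]; the kernel is the regular
   part of its second derivative in [x]. *)
Definition stein_kernel (t x : R) : R :=
  if t < x then Q (- t) * mills2 x else Q t * mills2 (- x).

Let phi0 x : 0 < phi x. Proof. exact: normal_pdf_gt0. Qed.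
Let phiN0 x : phi x != 0. Proof. by rewrite gt_eqF. Qed.

Let dphi (x : R) : is_derive x (1 : R) phi (- x * phi x).
Proof.
have := is_derive_normal_pdf n10 x; rewrite expr1n divr1//.
Qed.

Let dQ (x : R) : is_derive x (1 : R) Q (- phi x).
Proof. exact: is_derive_normal_tail. Qed.

Lemma tail_int_ge0 x : 0 <= tail_int x.
Proof.
rewrite subr_ge0; have [x0|x0] := leP 0 x.
  by have := mul_normal_tail_le n10 x0; rewrite expr1n mul1r.
apply: le_trans (ltW (phi0 x)).
by apply: mulr_le0_ge0; [exact: ltW|exact: normal_tail_ge0].
Qed.

Let dG (x : R) : is_derive x (1 : R) tail_int (- Q x).
Proof.
have h1 := dphi x; have h2 := dQ x.
apply: is_derive_eq; rewrite /GRing.scale/=; ring.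
Qed.

Lemma cvg_tail_int : tail_int x @[x --> +oo%R] --> (0 : R).
Proof.
rewrite -[X in _ --> X](subr0 0); apply: cvgB; first exact: cvg_normal_pdfy.
exact: cvg_normal_tailMy.
Qed.

Let cQ : continuous Q. Proof. exact: continuous_normal_tail. Qed.

(** The classical lower bound [x / (1 + x ^+ 2)] for the Mills ratio. The difference [D] has
    derivative [2 * tail_int >= 0] and tends to 0 at infinity, so it is nonpositive. *)
Lemma mills_lower x : 0 <= (1 + x ^+ 2) * Q x - x * phi x.
Proof.
pose D (x : R) := x * phi x - (1 + x ^+ 2) * Q x.
rewrite -oppr_le0 opprB -/(D x).
apply: (@le_primitive_y _ (fun x => 2 * tail_int x) D x 0).
- by move=> y _; rewrite mulr_ge0 ?tail_int_ge0.
- move=> y; apply: cvgM; first exact: cvg_cst.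
  by apply: is_derive_continuous; exact: dG.
- move=> y; have h1 := dphi y; have h2 := dQ y.
  apply: is_derive_eq; rewrite /GRing.scale/= /tail_int; ring.
- have -> : D = fun x => x * phi x - (Q x + x ^+ 2 * Q x).
    by apply/funext => y; rewrite /D; ring.
  rewrite -[X in _ --> X](subr0 0); apply: cvgB; first exact: cvg_normal_pdfMy.
  rewrite -[X in _ --> X](addr0 0); apply: cvgD; first exact: cvg_normal_taily.
  exact: cvg_normal_tailMMy.
Qed.

(** Convexity of the Mills ratio: up to the factor [phi x] this is [mills_lower]. It makes the Stein
    kernel nonnegative. *)
Lemma mills2_ge0 x : 0 <= mills2 x.
Proof.
have -> : mills2 x = ((1 + x ^+ 2) * Q x - x * phi x) / phi x.
  by rewrite /mills2 /mills; field.
by rewrite divr_ge0 ?mills_lower ?ltW.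
Qed.

Lemma mills_ge0 x : 0 <= mills x.
Proof. by rewrite divr_ge0 ?normal_tail_ge0 ?ltW. Qed.

Lemma is_derive_mills (x : R) : is_derive x (1 : R) mills (x * mills x - 1).
Proof.
have h1 := dphi x; have h2 := dQ x.
have h3 := is_deriveV (phiN0 x) h1.
rewrite /mills.
apply: is_derive_eq; rewrite /GRing.scale/=; field.
by [].
Qed.

Lemma is_derive_mills' (x : R) :
  is_derive x (1 : R) (fun x => x * mills x - 1) (mills2 x).
Proof.
have h := is_derive_mills x.
apply: is_derive_eq; rewrite /GRing.scale/= /mills2; ring.
Qed.

Lemma mills'E x : x * mills x - 1 = - (tail_int x / phi x).
Proof. by rewrite /mills /tail_int; field. Qed.

Lemma mills'_le0 x : x * mills x - 1 <= 0.
Proof. by rewrite mills'E oppr_le0 divr_ge0 ?tail_int_ge0 ?ltW. Qed.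

Lemma mills_nincr x y : x <= y -> mills y <= mills x.
Proof.
move=> xy; apply: (@ler0_derive1_nincry _ mills x) => //.
- by move=> z _; have [] := is_derive_mills z.
- by move=> z _; rewrite derive1E; have [_ ->] := is_derive_mills z; exact: mills'_le0.
- by apply: continuous_subspaceT => z; apply: is_derive_continuous; exact: is_derive_mills.
Qed.

Let cmills : continuous mills.
Proof. by move=> z; apply: is_derive_continuous; exact: is_derive_mills. Qed.

Let cmills2 : continuous mills2.
Proof.
move=> x; apply: cvgD; last exact: cmills.
apply: cvgM; first exact: cvg_id.
exact: (is_derive_continuous (is_derive_mills' x)).
Qed.

Lemma cvg_mills : mills x @[x --> +oo%R] --> (0 : R).
Proof.
apply: (@cvgy0_le_div _ 1) => x x1; have x0 : 0 < x by exact: lt_le_trans x1.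
rewrite ger0_norm ?mills_ge0// ler_pdivlMr//.
by have := mills'_le0 x; rewrite subr_le0 mulrC.
Qed.

(** With [u = x * mills x - 1], one has [x * mills2 x = (1 + x ^+ 2) * u + 1], which is nonnegative
    for [x > 0]. *)
Lemma mills'_ge x : 0 < x -> - (1 + x ^+ 2)^-1 <= x * mills x - 1.
Proof.
move=> x0; have x2 : 0 < 1 + x ^+ 2 by rewrite ltr_pwDl ?sqr_ge0.
rewrite -(ler_pM2l x2) mulrN divff ?gt_eqF//.
have := mulr_ge0 (ltW x0) (mills2_ge0 x); rewrite /mills2; nra.
Qed.

(** The derivative of [mills] decays like [x ^- 2], hence still vanishes after a linear factor. This
    is the boundary term at infinity of the first moment of the kernel. *)
Lemma cvg_mills' w : ((x - w) * (x * mills x - 1)) @[x --> +oo%R] --> (0 : R).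
Proof.
apply: (@cvgy0_le_div _ (1 + `|w|)) => x x1.
have x0 : 0 < x by exact: lt_le_trans x1.
have x2 : 0 < 1 + x ^+ 2 by rewrite ltr_pwDl ?sqr_ge0.
have h1 : `|x * mills x - 1| <= (1 + x ^+ 2)^-1.
  by rewrite ler0_norm ?mills'_le0// lerNl mills'_ge.
have h2 : `|x - w| <= (1 + `|w|) * x.
  rewrite (le_trans (ler_normB _ _))// (gtr0_norm x0) mulrDl mul1r lerD2l.
  by rewrite ler_peMr.
rewrite normrM (le_trans (ler_pM _ _ h2 h1))// -mulrA ler_wpM2l ?addr_ge0//.
by rewrite ler_pdivrMr// ler_pdivlMl//; nra.
Qed.

Lemma cvg_mills'1 : (x * mills x - 1) @[x --> +oo%R] --> (0 : R).
Proof.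
apply: (@cvgy0_le_div _ 1) => x x1.
have x0 : 0 < x by exact: lt_le_trans x1.
have x2 : 0 < 1 + x ^+ 2 by rewrite ltr_pwDl ?sqr_ge0.
rewrite ler0_norm ?mills'_le0// mul1r.
have := mills'_ge x0; rewrite lerNl => /le_trans; apply.
by rewrite lef_pV2 ?posrE//; nra.
Qed.

Lemma stein_kernel_ge0 t x : 0 <= stein_kernel t x.
Proof. by rewrite /stein_kernel; case: ifP => _; rewrite mulr_ge0 ?normal_tail_ge0 ?mills2_ge0. Qed.

Lemma measurable_stein_kernel :
  measurable_fun [set: R * R] (fun z => stein_kernel z.1 z.2).
Proof.
have mQ : measurable_fun [set: R] Q by exact: continuous_measurable_fun.
have mm : measurable_fun [set: R] mills2 by exact: continuous_measurable_fun.
rewrite /stein_kernel; apply: measurable_fun_ifT; first exact: measurable_fun_ltr.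
- apply: measurable_funM; last exact: measurableT_comp.
  by apply: measurableT_comp => //; apply: measurableT_comp.
- apply: measurable_funM; first exact: measurableT_comp.
  by apply: measurableT_comp => //; apply: measurableT_comp.
Qed.

Lemma integral_tail x :
  (\int[mu]_(t in `[x, +oo[) (Q t)%:E = (tail_int x)%:E)%E.
Proof.
have dF (y : R) : is_derive y (1 : R) (fun x => - tail_int x) (Q y).
  by have h := dG y; apply: is_derive_eq; exact: opprK.
rewrite (@ge0_integral_primitive_y _ _ (fun x => - tail_int x) _ 0)//.
- by rewrite sub0r opprK.
- by move=> y _; exact: normal_tail_ge0.
- by apply: cvg_oppy0; exact: cvg_tail_int.
Qed.

(** Splitting at [t = x] gives [mills2 x * tail_int (- x) + mills2 (- x) * tail_int x]. With
    [Q (- x) = 1 - Q x] every term containing [Q] cancels and [phi x / phi x] remains. *)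
Lemma integral_stein_kernel_threshold x :
  (\int[mu]_t (stein_kernel t x)%:E = 1)%E.
Proof.
have mH : measurable_fun [set: R] (fun t => stein_kernel t x).
  exact: (measurableT_comp measurable_stein_kernel (measurable_pair2 _)).
rewrite -(setUv `]-oo, x]%classic) ge0_integral_setU//=; last 4 first.
- exact: measurableC.
- by apply/measurable_EFinP; apply: measurable_funTS.
- by move=> t _; rewrite lee_fin stein_kernel_ge0.
- by apply/disj_set2P; rewrite setICr.
(* At [t = x] the kernel is on its second branch, so the right half-line is closed and the left one
   opened. *)
rewrite setCitvl integral_itv_obnd_cbnd; last first.
  by apply/measurable_EFinP; apply: measurable_funTS.
rewrite -integral_itv_bndo_bndc; last first.
  by apply/measurable_EFinP; apply: measurable_funTS.
have -> : (\int[mu]_(t in `]-oo, x[) (stein_kernel t x)%:E =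
    (mills2 x)%:E * \int[mu]_(t in `]-oo, x[) (Q (- t))%:E)%E.
  rewrite -ge0_integralZl//; last 3 first.
  - apply/measurable_EFinP; apply: measurable_funTS.
    by apply: measurableT_comp => //; exact: continuous_measurable_fun.
  - by move=> t _; rewrite lee_fin normal_tail_ge0.
  - by rewrite lee_fin mills2_ge0.
  apply: eq_integral => t; rewrite inE/= in_itv/= => tx.
  by rewrite /stein_kernel tx -EFinM mulrC.
have -> : (\int[mu]_(t in `[x, +oo[) (stein_kernel t x)%:E =
    (mills2 (- x))%:E * \int[mu]_(t in `[x, +oo[) (Q t)%:E)%E.
  rewrite -ge0_integralZl//; last 3 first.
  - apply/measurable_EFinP; apply: measurable_funTS; exact: continuous_measurable_fun.
  - by move=> t _; rewrite lee_fin normal_tail_ge0.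
  - by rewrite lee_fin mills2_ge0.
  apply: eq_integral => t; rewrite inE/= in_itv/= andbT => tx.
  have tx' : (t < x :> R) = false by apply/negbTE; rewrite -leNgt.
  by rewrite /stein_kernel tx' -EFinM mulrC.
rewrite integral_itv_bndo_bndc; last first.
  apply/measurable_EFinP; apply: measurable_funTS.
  by apply: measurableT_comp => //; exact: continuous_measurable_fun.
have -> : (\int[mu]_(t in `]-oo, x]) (Q (- t))%:E = \int[mu]_(t in `[(- x)%R, +oo[) (Q t)%:E)%E.
  rewrite -{1}(opprK x) ge0_integration_by_substitutionNy.
  - by apply: eq_integral => t _; rewrite /= opprK.
  - apply: continuous_subspaceT => t; apply: (@continuous_comp _ _ _ -%R Q).
      exact: oppr_continuous.
    exact: cQ.
  - by move=> t _; exact: normal_tail_ge0.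
rewrite !integral_tail -!EFinM -EFinD; congr (_%:E).
have e : Q (- x) = 1 - Q x := normal_tailN n10 x.
rewrite /tail_int /mills2 /mills e normal_pdfN// ; field.
by [].
Qed.

Lemma integral_stein_kernel_ge t w : t <= w ->
  (\int[mu]_(x in `[w, +oo[) (stein_kernel t x)%:E =
    (Q (- t) * (1 - w * mills w))%:E)%E.
Proof.
move=> tw; have dF1 (x : R) : is_derive x (1 : R)
    (fun x => Q (- t) * (x * mills x - 1)) (Q (- t) * mills2 x).
  have h := is_derive_mills' x.
  by apply: is_derive_eq; rewrite /GRing.scale/=.
rewrite (@integral_ifr_y _ t _ _ (fun x => Q (- t) * (x * mills x - 1)) 0)//.
- by congr (_%:E); ring.
- by move=> x; apply: cvgM; [exact: cvg_cst|exact: cmills2].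
- move=> x; apply: cvgM; first exact: cvg_cst.
  by apply: (@continuous_comp _ _ _ -%R mills2); [exact: oppr_continuous|exact: cmills2].
- by apply: cvg_mully0; exact: cvg_mills'1.
- by move=> x _; rewrite mulr_ge0 ?normal_tail_ge0 ?mills2_ge0.
Qed.

Lemma is_derive_mills'N (x : R) :
  is_derive x (1 : R) (fun x => 1 + x * mills (- x)) (mills2 (- x)).
Proof.
have h := is_derive_mills' (- x).
have h2 : is_derive x (1 : R) (fun x => - x * mills (- x) - 1) (- mills2 (- x)).
  have -> : - mills2 (- x) = mills2 (- x) * -1 by ring.
  apply: (is_derive1_comp (f := fun x : R => x * mills x - 1) h).
have -> : (fun x => 1 + x * mills (- x)) = (fun x => - (- x * mills (- x) - 1)).
  by apply/funext => y; ring.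
apply: is_derive_eq; exact: opprK.
Qed.

Lemma is_derive_millsN (x : R) :
  is_derive x (1 : R) (fun x => mills (- x)) (1 + x * mills (- x)).
Proof.
have h := is_derive_mills (- x).
have -> : 1 + x * mills (- x) = (- x * mills (- x) - 1) * -1 by ring.
exact: (is_derive1_comp (f := mills) h).
Qed.

(** The primitives on the two sides of [t] are the two branches of the derivative of the Stein
    solution. Their values at [t] differ by 1, the size of its jump, which is the constant term of
    the result. *)
Lemma integral_stein_kernel_lt t w : w < t ->
  (\int[mu]_(x in `[w, +oo[) (stein_kernel t x)%:E =
    (1 - Q t * (1 + w * mills (- w)))%:E)%E.
Proof.
move=> wt; have dF1 (x : R) : is_derive x (1 : R)
    (fun x => Q (- t) * (x * mills x - 1)) (Q (- t) * mills2 x).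
  have h := is_derive_mills' x.
  by apply: is_derive_eq; rewrite /GRing.scale/=.
have dF2 (x : R) : is_derive x (1 : R) (fun x => Q t * (1 + x * mills (- x))) (Q t * mills2 (- x)).
  have h := is_derive_mills'N x.
  by apply: is_derive_eq; rewrite /GRing.scale/=.
rewrite (@integral_if_y _ t _ _ (fun x => Q (- t) * (x * mills x - 1))
  (fun x => Q t * (1 + x * mills (- x))) 0)//.
- congr (_%:E).
  have e : Q (- t) = 1 - Q t := normal_tailN n10 t.
  rewrite /mills e normal_pdfN//; field.
  by rewrite !phiN0.
- by move=> x; apply: cvgM; [exact: cvg_cst|exact: cmills2].
- move=> x; apply: cvgM; first exact: cvg_cst.
  by apply: (@continuous_comp _ _ _ -%R mills2); [exact: oppr_continuous|exact: cmills2].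
- by apply: cvg_mully0; exact: cvg_mills'1.
- by move=> x _; rewrite mulr_ge0 ?normal_tail_ge0 ?mills2_ge0.
- by move=> x _; rewrite mulr_ge0 ?normal_tail_ge0 ?mills2_ge0.
Qed.

(** By parts, [(x - w) f''] has the primitive [(x - w) f' - f] for the Stein solution [f]. Only the
    boundary value [f(w)] survives. *)
Lemma integral_stein_kernelM_ge t w : t <= w ->
  (\int[mu]_(x in `[w, +oo[) (stein_kernel t x * (x - w))%:E =
    (Q (- t) * mills w)%:E)%E.
Proof.
move=> tw; under eq_integral do rewrite /stein_kernel (fun_if (fun a => a * _)).
have dF1 (x : R) : is_derive x (1 : R)
    (fun x => Q (- t) * ((x - w) * (x * mills x - 1) - mills x)) (Q (- t) * mills2 x * (x - w)).
  have h := is_derive_mills' x; have h2 := is_derive_mills x.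
  apply: is_derive_eq; rewrite /GRing.scale/=; ring.
rewrite (@integral_ifr_y _ t _ _ (fun x => Q (- t) * ((x - w) * (x * mills x - 1) - mills x)) 0)//.
- by congr (_%:E); ring.
- move=> x; apply: cvgM; [apply: cvgM; [exact: cvg_cst|exact: cmills2]|].
  by apply: cvgB => //; exact: cvg_cst.
- move=> x; apply: cvgM; last by apply: cvgB => //; exact: cvg_cst.
  apply: cvgM; first exact: cvg_cst.
  by apply: (@continuous_comp _ _ _ -%R mills2); [exact: oppr_continuous|exact: cmills2].
- apply: cvg_mully0; rewrite -[X in _ --> X](subr0 0); apply: cvgB; first exact: cvg_mills'.
  exact: cvg_mills.
- by move=> x wx; rewrite !mulr_ge0 ?normal_tail_ge0 ?mills2_ge0 ?subr_ge0.
Qed.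

(** Again the value [f(w)] of the Stein solution, now with the jump of [f'] at [t] counted with the
    weight [t - w]. *)
Lemma integral_stein_kernelM_lt t w : w < t ->
  (\int[mu]_(x in `[w, +oo[) (stein_kernel t x * (x - w))%:E =
    (t - w + Q t * mills (- w))%:E)%E.
Proof.
move=> wt; under eq_integral do rewrite /stein_kernel (fun_if (fun a => a * _)).
have dF1 (x : R) : is_derive x (1 : R)
    (fun x => Q (- t) * ((x - w) * (x * mills x - 1) - mills x)) (Q (- t) * mills2 x * (x - w)).
  have h := is_derive_mills' x; have h2 := is_derive_mills x.
  apply: is_derive_eq; rewrite /GRing.scale/=; ring.
have dF2 (x : R) : is_derive x (1 : R)
    (fun x => Q t * ((x - w) * (1 + x * mills (- x)) - mills (- x))) (Q t * mills2 (- x) * (x - w)).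
  have h := is_derive_mills'N x; have h2 := is_derive_millsN x.
  apply: is_derive_eq; rewrite /GRing.scale/=; ring.
rewrite (@integral_if_y _ t _ _ (fun x => Q (- t) * ((x - w) * (x * mills x - 1) - mills x))
  (fun x => Q t * ((x - w) * (1 + x * mills (- x)) - mills (- x))) 0)//.
- congr (_%:E).
  have e : Q (- t) = 1 - Q t := normal_tailN n10 t.
  rewrite /mills e normal_pdfN//; field.
  by rewrite !phiN0.
- move=> x; apply: cvgM; [apply: cvgM; [exact: cvg_cst|exact: cmills2]|].
  by apply: cvgB => //; exact: cvg_cst.
- move=> x; apply: cvgM; last by apply: cvgB => //; exact: cvg_cst.
  apply: cvgM; first exact: cvg_cst.
  by apply: (@continuous_comp _ _ _ -%R mills2); [exact: oppr_continuous|exact: cmills2].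
- apply: cvg_mully0; rewrite -[X in _ --> X](subr0 0); apply: cvgB; first exact: cvg_mills'.
  exact: cvg_mills.
- by move=> x tx; rewrite !mulr_ge0 ?normal_tail_ge0 ?mills2_ge0 ?subr_ge0 ?(le_trans (ltW wt)).
- by move=> x wx; rewrite !mulr_ge0 ?normal_tail_ge0 ?mills2_ge0 ?subr_ge0.
Qed.

End stein_kernel.

(** * Translation and independence *)

Section lebesgue_translation.
Context {R : realType}.
Let mu := @lebesgue_measure R.

(** The image of Lebesgue measure under the translation has the right value on half-open intervals,
    which determine the measure. *)
Lemma ge0_integral_translation (f : R -> \bar R) (b : R) :
  measurable_fun [set: R] f -> (forall x, (0 <= f x)%E) ->
  (\int[mu]_x f (x - b)%R = \int[mu]_x f x)%E.
Proof.
move=> mf f0.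
have mb : @measurable_fun _ _ (measurableTypeR R) (measurableTypeR R) setT (fun x => x - b).
  by apply: measurable_funB.
pose phi : {mfun measurableTypeR R >-> measurableTypeR R} :=
    @mfun_Sub _ _ (measurableTypeR R) (measurableTypeR R) (fun x => x - b) (mem_set mb).
have E A : measurable A -> mu A = pushforward mu phi A.
  apply: lebesgue_measure_unique => _ [[x y] /= _ <-].
  rewrite /pushforward.
  have -> : phi @^-1` `]x, y] = `](x + b), (y + b)]%classic.
    by apply/seteqP; split => z /=; rewrite !in_itv/= /mfun_Sub/= ltrBrDr lerBlDr.
  rewrite !lebesgue_measure_itv/= !lte_fin ltrD2r; case: ifP => // _.
  by rewrite -!EFinB; congr EFin; ring.
rewrite [RHS](eq_measure_integral (pushforward mu phi)) => [|A mA _]; last exact: E.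
by rewrite ge0_integral_pushforward//; exact: measurable_funTS.
Qed.

End lebesgue_translation.

Section independence.
Context d (T : measurableType d) (R : realType) (P : probability T R).

(* Unlike [integral_distribution], no integrability is needed: both sides are
   the same difference of integrals of nonnegative functions. *)
Lemma integral_law d' (T' : measurableType d') (X : {RV P >-> T'}) (f : T' -> \bar R) :
  measurable_fun [set: T'] f ->
  (\int[distribution P X]_y f y = \int[P]_w f (X w))%E.
Proof.
move=> mf; rewrite integralE [RHS]integralE; congr (_ - _)%E.
- rewrite ge0_integral_distribution//; last exact: measurable_funepos.
  by apply: eq_integral => w _; rewrite -funepos_comp.
- rewrite ge0_integral_distribution//; last exact: measurable_funeneg.
  by apply: eq_integral => w _; rewrite -funeneg_comp.
Qed.

(** Independence fixes the joint law on rectangles, hence identifies it with the product of the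
    marginal laws. Fubini then freezes [V] at an outcome [v]. *)
Lemma independent2_integral (X V : {RV P >-> R}) (h : R * R -> R) :
  independent2 X V -> measurable_fun [set: R * R] h ->
  P.-integrable [set: T] (fun w => (h (X w, V w))%:E) ->
  (\int[P]_w (h (X w, V w))%:E = \int[P]_v \int[P]_w (h (X w, V v))%:E)%E.
Proof.
move=> XV mh ih.
have mXV : measurable_fun [set: T] (fun w => (X w, V w)).
  by apply/measurable_fun_pairP; split; exact: measurable_funP.
pose XVm : {mfun T >-> (R * R)%type} := mfun_Sub (mem_set mXV).
have E (A : set (R * R)) : measurable A ->
    (distribution P X \x distribution P V)%E A = distribution P XVm A.
  apply: product_measure_unique => B C mB mC.
  by rewrite /distribution /pushforward /= -XV.
have mh' : measurable_fun [set: R * R] (EFin \o h) by exact/measurable_EFinP.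
have ih' : (distribution P XVm).-integrable [set: R * R] (EFin \o h).
  by apply: integrable_pushforward => //; rewrite preimage_setT.
have ihp : (distribution P X \x distribution P V)%E.-integrable [set: R * R] (EFin \o h).
  apply/integrableP; split => //; move/integrableP : ih' => [_]; apply: le_lt_trans.
  by rewrite le_eqVlt; apply/orP; left; apply/eqP; apply: eq_measure_integral => A mA _; exact: E.
transitivity (\int[distribution P XVm]_z (h z)%:E)%E.
  by rewrite (integral_law XVm mh').
transitivity (\int[distribution P X \x distribution P V]_z (h z)%:E)%E.
  by apply: eq_measure_integral => A mA _; exact/esym/E.
have := integral21_prod_meas1 ihp; rewrite /= => <-.
transitivity (\int[P]_v fubini_G (distribution P X) (EFin \o h) (V v))%E.
  by apply: integral_law; exact: (measurable_fubini_G ihp).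
apply: eq_integral => v _; rewrite /fubini_G (integral_law X (f := fun x => (h (x, V v))%:E))//.
by apply/measurable_EFinP; exact: measurable_fun_pair1.
Qed.
End independence.

(** * Stein's identity for half-lines *)

(** A Taylor remainder kernel: for a smooth [f] decaying fast enough at infinity, [s f'(x) - x f(x)]
    is minus the integral over [t] of [f''(t) * bias_integrand s t x]. *)
Definition bias_integrand (R : realType) (s t x : R) : R :=
  if x <= t then s + x * (t - x) else 0.

Definition bias_defect d (T : measurableType d) (R : realType)
    (P : probability T R) (X : T -> R) (s t : R) : \bar R :=
  (\int[P]_w (bias_integrand s t (X w))%:E)%E.

Section bias_defect.
Context d (T : measurableType d) (R : realType) (P : probability T R).

Lemma measurable_bias_integrand d' (T' : measurableType d') (s : R) (f g : T' -> R) :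
  measurable_fun [set: T'] f -> measurable_fun [set: T'] g ->
  measurable_fun [set: T'] (fun z => bias_integrand s (f z) (g z)).
Proof.
move=> mf mg; apply: measurable_fun_ifT => //; first exact: measurable_fun_ler.
apply: measurable_funD => //; apply: measurable_funM => //; exact: measurable_funB.
Qed.

Lemma normr_bias_integrand_le (s t x : R) :
  `|bias_integrand s t x| <= `|s| + t ^+ 2 + 2 * x ^+ 2.
Proof.
rewrite /bias_integrand; case: ifP => _; last first.
  have := normr_ge0 s; have := sqr_ge0 t; have := sqr_ge0 x; rewrite normr0; lra.
rewrite (le_trans (ler_normD _ _))// -addrA lerD2l mulrBr ler_norml; nra.
Qed.

(** Quadratic growth in two square integrable variables is the common form of the integrability
    claims about sums and shifted thresholds. *)
Lemma integrable_le_sqr (X V f : T -> R) (C D : R) :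
  P.-integrable [set: T] (fun w => (X w ^+ 2)%:E) ->
  P.-integrable [set: T] (fun w => (V w ^+ 2)%:E) ->
  measurable_fun [set: T] f ->
  (forall w, `|f w| <= C + D * (X w ^+ 2 + V w ^+ 2)) ->
  P.-integrable [set: T] (EFin \o f).
Proof.
move=> iX iV mf fle.
apply: (@le_integrable _ _ _ P _ measurableT _
  (fun w => C%:E + D%:E * ((X w ^+ 2)%:E + (V w ^+ 2)%:E))%E).
- exact/measurable_EFinP.
- move=> w _; rewrite /= lee_fin.
  by rewrite (le_trans (fle w))// ler_norm.
- apply: integrableD => //; first exact: finite_measure_integrable_cst.
  by apply: integrableZl => //; exact: integrableD.
Qed.

(** Tonelli gives the measurability for the positive and the negative part, and the integral is by
    definition the difference of their integrals, whether or not [f] is integrable. *)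
Lemma measurable_integral_section d' (T' : measurableType d') (f : T' * T -> \bar R) :
  measurable_fun [set: T' * T] f ->
  measurable_fun [set: T'] (fun x => \int[P]_w f (x, w))%E.
Proof.
move=> mf.
rewrite [X in measurable_fun _ X](_ : _ = fun x =>
  \int[P]_w f^\+%E (x, w) - \int[P]_w f^\-%E (x, w))%E; last first.
  apply/funext => x; rewrite integralE; congr (_ - _)%E;
    by apply: eq_integral => w _; rewrite ?funeposE ?funenegE.
apply: emeasurable_funB.
- apply: (measurable_fun_fubini_tonelli_F (m2 := P)) => //; exact: measurable_funepos.
- apply: (measurable_fun_fubini_tonelli_F (m2 := P)) => //; exact: measurable_funeneg.
Qed.

Lemma measurable_bias_defect (X : T -> R) (s : R) : measurable_fun [set: T] X ->
  measurable_fun [set: R] (bias_defect P X s).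
Proof.
move=> mX.
have mk : measurable_fun [set: (R * T)%type] (fun z => (bias_integrand s z.1 (X z.2))%:E).
  apply/measurable_EFinP; apply: measurable_bias_integrand => //.
  exact: measurableT_comp.
exact: (measurable_integral_section mk).
Qed.

Lemma integrable_bias_integrand (X : T -> R) (s t : R) :
  measurable_fun [set: T] X -> P.-integrable [set: T] (fun w => (X w ^+ 2)%:E) ->
  P.-integrable [set: T] (fun w => (bias_integrand s t (X w))%:E).
Proof.
move=> mX iX; apply: (@integrable_le_sqr X X _ (`|s| + t ^+ 2) 1) => //.
- exact: measurable_bias_integrand.
- move=> w; rewrite (le_trans (normr_bias_integrand_le _ _ _))// lerD2l; lra.
Qed.

End bias_defect.

Section stein_identity.
Context {R : realType}.
Let mu := @lebesgue_measure R.
Local Notation Q := (normal_tail 1 : R -> R).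
Let n10 : (1 : R) != 0. Proof. exact: oner_neq0. Qed.
Local Hint Resolve n10 : core.

Lemma PhiE (t : R) : Phi t = (Q (- t))%:E.
Proof. by rewrite /Phi /normal_prob normal_tailNE. Qed.

Let measurable_kernel t : measurable_fun [set: R] (stein_kernel t).
Proof. exact: (measurableT_comp (@measurable_stein_kernel R) (measurable_pair1 t)). Qed.

Let mk t (D : set R) : measurable_fun D (fun x => (stein_kernel t x)%:E).
Proof. by apply/measurable_EFinP; apply: measurable_funTS. Qed.

Let mkM t (w : R) (D : set R) : measurable_fun D (fun x => (stein_kernel t x * (x - w))%:E).
Proof.
apply/measurable_EFinP; apply: measurable_funTS; apply: measurable_funM => //.
exact: measurable_funB.
Qed.

Lemma integral_stein_kernel_le1 (t w : R) :
  (\int[mu]_(x in `[w, +oo[) (stein_kernel t x)%:E <= 1)%E.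
Proof.
have lt1 v : v < t -> (\int[mu]_(x in `[v, +oo[) (stein_kernel t x)%:E <= 1)%E.
  move=> vt; rewrite integral_stein_kernel_lt// lee_fin gerBl mulr_ge0 ?normal_tail_ge0//.
  by have := mills'_le0 (- v); lra.
have [tw|] := leP t w; last exact: lt1.
(* For [t <= w] the interval is enlarged to start below [t], where the mass is 1 minus a nonnegative
   term; any point below [t] would do. *)
apply: le_trans (lt1 (t - 1) _); last by rewrite ltrBlDr ltrDl.
apply: ge0_subset_integral => //.
- exact: mk.
- by move=> x _; rewrite lee_fin stein_kernel_ge0.
- by apply: subset_itvr; rewrite bnd_simp lerBlDr (le_trans tw)// lerDl.
Qed.

(** The Stein solution increases up to [t] and decreases afterwards, so the two branch values at [t]
    dominate it. The term [|t|], together with [|w|], absorbs the jump contribution [t - w]. Only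
    finiteness matters. *)
Definition stein_kernel_bound (t : R) := `|t| + Q (- t) * mills t + Q t * mills (- t).

Lemma integral_stein_kernelM_le (t w : R) :
  (\int[mu]_(x in `[w, +oo[) (stein_kernel t x * (x - w))%:E <=
    (stein_kernel_bound t + `|w|)%:E)%E.
Proof.
have q1 := normal_tail_ge0 1 t; have q2 := normal_tail_ge0 1 (- t).
have m1 := mills_ge0 t; have m2 := mills_ge0 (- t).
have n1 := normr_ge0 w; have n2 := normr_ge0 t.
have h1 := mulr_ge0 q1 m2; have h2 := mulr_ge0 q2 m1.
have [tw|wt] := leP t w.
- rewrite integral_stein_kernelM_ge// lee_fin /stein_kernel_bound.
  have := ler_wpM2l q2 (mills_nincr tw); lra.
- rewrite integral_stein_kernelM_lt// lee_fin /stein_kernel_bound.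
  have nwt : - t <= - w by rewrite lerN2 ltW.
  have := ler_wpM2l q1 (mills_nincr nwt).
  have := ler_norm t; have := ler_norm (- w); rewrite normrN; lra.
Qed.

Lemma integral_bias_integrandE (t w : R) (s : R) (f : R -> R) :
  (\int[mu]_x (f x * bias_integrand s x w)%:E =
   \int[mu]_(x in `[w, +oo[) (f x * (s + w * (x - w)))%:E)%E.
Proof.
rewrite [RHS]integral_mkcond; apply: eq_integral => x _.
rewrite /bias_integrand patchE; case: ifPn => wx.
  by rewrite mem_set//= in_itv/= wx.
by rewrite memNset ?mulr0//= in_itv/= andbT; exact/negP.
Qed.

Lemma ge0_integrable_le (D : set R) (f : R -> R) (C : R) : measurable D ->
  measurable_fun D (EFin \o f) -> (forall x, D x -> 0 <= f x) ->
  (\int[mu]_(x in D) (f x)%:E <= C%:E)%E -> mu.-integrable D (EFin \o f).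
Proof.
move=> mD mf f0 fC; apply/integrableP; split => //.
apply: le_lt_trans (ltry C); apply: le_trans fC.
rewrite le_eqVlt; apply/orP; left; apply/eqP; apply: eq_integral => x; rewrite inE => Dx.
by rewrite /= ger0_norm ?f0.
Qed.

Let kernel_integrable t (w : R) :
  mu.-integrable `[w, +oo[ (fun x => (stein_kernel t x)%:E).
Proof.
apply: (ge0_integrable_le _ _ _ (integral_stein_kernel_le1 t w)) => //.
- exact: mk.
- by move=> x _; exact: stein_kernel_ge0.
Qed.

Let kernelM_integrable t (w : R) :
  mu.-integrable `[w, +oo[ (fun x => (stein_kernel t x * (x - w))%:E).
Proof.
apply: (ge0_integrable_le _ _ _ (integral_stein_kernelM_le t w)) => //.
- exact: mkM.
- by move=> x; rewrite /= in_itv/= andbT => wx; rewrite mulr_ge0 ?stein_kernel_ge0 ?subr_ge0.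
Qed.

(** Stein's equation with [f] and [f'] expressed by [f'']. The Mills ratios cancel between the mass
    and the first moment of the kernel above [w]. The jump contributes [1 + w * (t - w)] when
    [w <= t]; its 1 cancels the indicator of the equation and [bias_integrand 0 t w] is left. *)
Lemma stein_identity (t w : R) :
  (\int[mu]_x (stein_kernel t x * bias_integrand 1 x w)%:E =
    (Q (- t) + bias_integrand 0 t w)%:E)%E.
Proof.
rewrite integral_bias_integrandE//.
have -> : (\int[mu]_(x in `[w, +oo[) (stein_kernel t x * (1 + w * (x - w)))%:E =
    \int[mu]_(x in `[w, +oo[) (stein_kernel t x)%:E +
    w%:E * \int[mu]_(x in `[w, +oo[) (stein_kernel t x * (x - w))%:E)%E.
  rewrite -integralZl// -integralD//; last exact: integrableZl.
  by apply: eq_integral => x _; rewrite -EFinM -EFinD; congr EFin; ring.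
rewrite /bias_integrand; have [tw|wt] := ltP t w.
- rewrite integral_stein_kernel_ge ?integral_stein_kernelM_ge ?(ltW tw)//.
  by rewrite -EFinM -EFinD; congr EFin; ring.
have : Q (- t) = 1 - Q t := normal_tailN n10 t.
(* At [w = t] the indicator is on, but the kernel formulas are those of [t <= w]. *)
move: wt; rewrite le_eqVlt => /predU1P[->|wt] e.
- rewrite integral_stein_kernel_ge ?integral_stein_kernelM_ge//.
  by rewrite -EFinM -EFinD; congr EFin; ring.
- rewrite integral_stein_kernel_lt ?integral_stein_kernelM_lt// e.
  by rewrite -EFinM -EFinD; congr EFin; ring.
Qed.

(** The bound has degree two in [w], so square integrability of [W] justifies the exchange of
    integrals. *)
Lemma integral_norm_stein_kernel_bias (t w : R) :
  (\int[mu]_x `|(stein_kernel t x * bias_integrand 1 x w)%:E| <=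
    (1 + `|w| * (stein_kernel_bound t + `|w|))%:E)%E.
Proof.
have -> : (\int[mu]_x `|(stein_kernel t x * bias_integrand 1 x w)%:E| =
    \int[mu]_(x in `[w, +oo[) `|stein_kernel t x * (1 + w * (x - w))|%:E)%E.
  rewrite [RHS]integral_mkcond; apply: eq_integral => x _.
  rewrite /bias_integrand patchE; case: ifPn => wx.
    by rewrite mem_set//= in_itv/= wx.
  by rewrite memNset ?mulr0 ?abse0//= in_itv/= andbT; exact/negP.
apply: (@le_trans _ _ (\int[mu]_(x in `[w, +oo[) ((stein_kernel t x)%:E +
    `|w|%:E * (stein_kernel t x * (x - w))%:E))%E).
  apply: ge0_le_integral => //.
  - apply/measurable_EFinP; apply: measurableT_comp => //; apply: measurable_funTS.
    apply: measurable_funM; first exact: measurable_kernel.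
    apply: measurable_funD => //.
    by apply: measurable_funM => //; exact: measurable_funB.
  - by apply: emeasurable_funD; [exact: mk|apply: measurable_funeM; exact: mkM].
  - move=> x; rewrite /= in_itv/= andbT => wx.
    rewrite -EFinM -EFinD lee_fin normrM (ger0_norm (stein_kernel_ge0 _ _)).
    have k0 := stein_kernel_ge0 t x.
    rewrite mulrCA -{2}[stein_kernel t x]mulr1 -mulrDr ler_wpM2l//.
    rewrite (le_trans (ler_normD _ _))// normr1 lerD2l normrM.
    by rewrite (@ger0_norm _ (x - w)) ?subr_ge0.
rewrite ge0_integralD//; last 4 first.
- by move=> x _; rewrite lee_fin stein_kernel_ge0.
- exact: mk.
- move=> x; rewrite /= in_itv/= andbT => wx; rewrite -EFinM lee_fin.
  by rewrite !mulr_ge0 ?stein_kernel_ge0 ?subr_ge0.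
- by apply: measurable_funeM; exact: mkM.
rewrite ge0_integralZl//; last 2 first.
- exact: mkM.
- move=> x; rewrite /= in_itv/= andbT => wx.
  by rewrite lee_fin mulr_ge0 ?stein_kernel_ge0 ?subr_ge0.
rewrite EFinD EFinM; apply: leeD; first exact: integral_stein_kernel_le1.
by apply: lee_wpmul2l; [rewrite lee_fin|exact: integral_stein_kernelM_le].
Qed.

End stein_identity.

(** * The distance to the normal law bounded by the bias defect *)

Section stein_bound.
Context d (T : measurableType d) (R : realType) (P : probability T R).
Let mu := @lebesgue_measure R.
Variable W : {RV P >-> R}.
Hypothesis iW : P.-integrable [set: T] (fun w => (W w ^+ 2)%:E).

Let iW1 : P.-integrable [set: T] (fun w => `|W w|%:E).
Proof.
apply: (@integrable_le_sqr _ _ _ P W W _ 1 1) => //.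
- exact: measurableT_comp.
- by move=> w; rewrite normr_id ler_norml; have := sqr_ge0 (W w); nra.
Qed.

Lemma bias_defect_cdf (s t : R) :
  bias_defect P W s t = (s%:E * cdf W t + bias_defect P W 0 t)%E.
Proof.
have mA : measurable (W @^-1` `]-oo, t]).
  by rewrite -[X in measurable X]setTI; exact: measurable_funP.
have -> : cdf W t = (\int[P]_w (\1_(W @^-1` `]-oo, t]) w)%:E)%E.
  by rewrite integral_indic// setIT.
rewrite /bias_defect -integralZl//; last exact: integrable_indic.
rewrite -integralD//; last 2 first.
- by apply: integrableZl => //; exact: integrable_indic.
- exact: integrable_bias_integrand.
apply: eq_integral => w _; rewrite -EFinM -EFinD; congr EFin.
rewrite indicE /bias_integrand; case: ifPn => h.
  by rewrite mem_set ?mulr1 ?add0r//= in_itv.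
by rewrite memNset ?mulr0 ?addr0//= in_itv/=; exact/negP.
Qed.

Lemma bias_defect_fin_num (s t : R) : bias_defect P W s t \is a fin_num.
Proof. by apply: integrable_fin_num => //; exact: integrable_bias_integrand. Qed.

Let mHk t : measurable_fun [set: (measurableTypeR R * T)%type]
  (fun z => (stein_kernel t z.1 * bias_integrand 1 z.1 (W z.2))%:E).
Proof.
apply/measurable_EFinP; apply: measurable_funM.
  have mH : measurable_fun [set: R] (stein_kernel t).
    exact: (measurableT_comp (@measurable_stein_kernel R) (measurable_pair1 t)).
  exact: (measurableT_comp mH measurable_fst).
apply: measurable_bias_integrand => //.
exact: measurableT_comp.
Qed.

(** This is [stein_identity] at [w = W], averaged over [P] after an exchange of integrals. The
    distribution function of [W] is exactly the difference between the defects with [s = 1] and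
    [s = 0]. *)
Lemma cdf_sub_Phi (t : R) :
  (cdf W t - Phi t =
   bias_defect P W 1 t - \int[mu]_x ((stein_kernel t x)%:E * bias_defect P W 1 x))%E.
Proof.
have ih : (mu \x P)%E.-integrable [set: (measurableTypeR R * T)%type]
    (fun z => (stein_kernel t z.1 * bias_integrand 1 z.1 (W z.2))%:E).
  apply/integrable21ltyP => //.
  apply: (@le_lt_trans _ _ (\int[P]_w (1 + `|W w| * (stein_kernel_bound t + `|W w|))%:E)%E).
    apply: ge0_le_integral => //.
    - by move=> w _; apply: integral_ge0 => x _; exact: abse_ge0.
    - have ma : measurable_fun [set: (measurableTypeR R * T)%type]
          (fun z => `|(stein_kernel t z.1 * bias_integrand 1 z.1 (W z.2))%:E|%E).
        exact: measurableT_comp.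
      exact: (measurable_fun_fubini_tonelli_G (m1 := mu) _ ma (fun=> abse_ge0 _)).
    - apply/measurable_EFinP; apply: measurable_funD => //; apply: measurable_funM.
        exact: measurableT_comp.
      by apply: measurable_funD => //; exact: measurableT_comp.
    - by move=> w _; exact: (integral_norm_stein_kernel_bias t (W w)).
  apply: integrable_lty => //.
  under eq_fun do rewrite mulrDr EFinD EFinD -normrM -expr2 ger0_norm ?sqr_ge0// mulrC EFinM.
  apply: integrableD => //; first exact: finite_measure_integrable_cst.
  by apply: integrableD => //; exact: integrableZl.
have -> : (\int[mu]_x ((stein_kernel t x)%:E * bias_defect P W 1 x) =
    \int[mu]_x \int[P]_w (stein_kernel t x * bias_integrand 1 x (W w))%:E)%E.
  apply: eq_integral => x _; rewrite /bias_defect -integralZl//.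
  exact: integrable_bias_integrand.
rewrite (Fubini ih)/=.
rewrite [X in (bias_defect P W 1 t - X)%E](_ : _ = \int[P]_w
    ((normal_tail 1 (- t))%:E + (bias_integrand 0 t (W w))%:E))%E; last first.
  by apply: eq_integral => w _; rewrite -EFinD; exact: (stein_identity t (W w)).
rewrite integralD//; last 2 first.
- exact: finite_measure_integrable_cst.
- exact: integrable_bias_integrand.
rewrite integral_cst// [X in (_ * X + _)%E](_ : _ = 1%E); last exact: probability_setT.
rewrite mule1 bias_defect_cdf mul1e PhiE.
have := bias_defect_fin_num 0 t; rewrite /bias_defect.
have : cdf W t \is a fin_num by exact: fin_num_measure.
case: (cdf W t) => // c _; case: (\int[P]_w _)%E => // k _.
by rewrite -!EFinD; congr EFin; ring.
Qed.

(** The absolute value is taken inside the kernel integral, after which everything is nonnegative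
    and Tonelli allows integrating in the threshold first. The right-hand side may be infinite. *)
Lemma L1dist_cdf_Phi :
  (L1dist (cdf W) (@Phi R) <= 2%:E * \int[mu]_t `|bias_defect P W 1 t|)%E.
Proof.
have mk : measurable_fun [set: R] (bias_defect P W 1).
  exact: measurable_bias_defect.
have mka : measurable_fun [set: R] (fun t => `|bias_defect P W 1 t|%E) by exact: measurableT_comp.
have mHk2 : measurable_fun [set: (measurableTypeR R * measurableTypeR R)%type]
    (fun z => (stein_kernel z.1 z.2)%:E * `|bias_defect P W 1 z.2|)%E.
  apply: emeasurable_funM.
    by apply/measurable_EFinP; exact: measurable_stein_kernel.
  exact: (measurableT_comp mka measurable_snd).
have Hk0 (z : R * R) : (0 <= (stein_kernel z.1 z.2)%:E * `|bias_defect P W 1 z.2|)%E.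
  by rewrite mule_ge0 ?abse_ge0// lee_fin stein_kernel_ge0.
have mF : measurable_fun [set: R]
    (fun t => \int[mu]_x ((stein_kernel t x)%:E * `|bias_defect P W 1 x|))%E.
  exact: (measurable_fun_fubini_tonelli_F (m2 := mu) _ mHk2 Hk0).
rewrite /L1dist.
apply: (@le_trans _ _ (\int[mu]_t (`|bias_defect P W 1 t| +
    \int[mu]_x ((stein_kernel t x)%:E * `|bias_defect P W 1 x|)))%E).
  apply: ge0_le_integral => //.
  - apply: measurableT_comp => //; apply: emeasurable_funB; first exact: cdf_measurable.
    rewrite (_ : @Phi R = EFin \o (fun t => normal_tail 1 (- t))); last first.
      by apply/funext => t; rewrite PhiE.
    apply/measurable_EFinP; apply: measurableT_comp => //.
    by apply: continuous_measurable_fun; apply: continuous_normal_tail; exact: oner_neq0.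
  - by apply: emeasurable_funD.
  - move=> t _; rewrite cdf_sub_Phi (le_trans (lee_abs_sub _ _))// leeD2l//.
    apply: (le_trans (le_abse_integral _ _ _)) => //.
      apply: emeasurable_funM => //.
      apply/measurable_EFinP.
      exact: (measurableT_comp (@measurable_stein_kernel R) (measurable_pair1 t)).
    rewrite le_eqVlt; apply/orP; left; apply/eqP; apply: eq_integral => x _.
    by rewrite abseM gee0_abs// lee_fin stein_kernel_ge0.
rewrite ge0_integralD//; last first.
  by move=> t _; apply: integral_ge0 => x _; exact: (Hk0 (t, x)).
rewrite (fubini_tonelli (m1 := mu) (m2 := mu) _ mHk2 Hk0)/=.
have -> : (\int[mu]_y \int[mu]_x ((stein_kernel x y)%:E * `|bias_defect P W 1 y|) =
    \int[mu]_y `|bias_defect P W 1 y|)%E.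
  apply: eq_integral => y _; rewrite ge0_integralZr//.
  - by rewrite integral_stein_kernel_threshold mul1e.
  - apply/measurable_EFinP.
    exact: (measurableT_comp (@measurable_stein_kernel R) (measurable_pair2 y)).
  - by move=> x _; rewrite lee_fin stein_kernel_ge0.
by rewrite -mule2n mule_natl.
Qed.

End stein_bound.

(** * Sums of independent variables *)

Section sum_of_independent.
Context d (T : measurableType d) (R : realType) (P : probability T R).
Let mu := @lebesgue_measure R.

Let integrable_shifted (X V : {RV P >-> R}) (s x : R) :
  P.-integrable [set: T] (fun w => (X w ^+ 2)%:E) ->
  P.-integrable [set: T] (fun w => (V w ^+ 2)%:E) ->
  P.-integrable [set: T] (fun w => (bias_integrand s (x - V w) (X w))%:E).
Proof.
move=> iX iV; apply: (@integrable_le_sqr _ _ _ P X V _ (`|s| + 2 * x ^+ 2) 2) => //.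
  by apply: measurable_bias_integrand => //; exact: measurable_funB.
move=> w; rewrite (le_trans (normr_bias_integrand_le _ _ _))// -addrA -addrA lerD2l.
by have := sqr_ge0 (x + V w); nra.
Qed.

Let measurable_shifted (X V : {RV P >-> R}) (s : R) :
  measurable_fun [set: R] (fun x => \int[P]_w (bias_integrand s (x - V w) (X w))%:E)%E.
Proof.
apply: (@measurable_integral_section _ _ _ P _ _ (fun z : R * T =>
  (bias_integrand s (z.1 - V z.2) (X z.2))%:E)).
apply/measurable_EFinP; apply: measurable_bias_integrand; last exact: measurableT_comp.
by apply: measurable_funB => //; exact: measurableT_comp.
Qed.

Lemma bias_defect_translate (X V : {RV P >-> R}) (s x : R) : independent2 X V ->
  P.-integrable [set: T] (fun w => (X w ^+ 2)%:E) ->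
  P.-integrable [set: T] (fun w => (V w ^+ 2)%:E) ->
  (\int[P]_w (bias_integrand s (x - V w) (X w))%:E =
   \int[P]_v bias_defect P X s (x - V v)%R)%E.
Proof.
move=> XV iX iV.
apply: (@independent2_integral _ _ _ P X V (fun z => bias_integrand s (x - z.2) z.1)) => //.
- by apply: measurable_bias_integrand => //; exact: measurable_funB.
- exact: integrable_shifted.
Qed.

(** By independence the left integrand is the defect of [X] averaged over translations by [V], and
    averaging translates does not increase the L1 norm. *)
Lemma integral_bias_defect_translate_le (X V : {RV P >-> R}) (s : R) :
  independent2 X V ->
  P.-integrable [set: T] (fun w => (X w ^+ 2)%:E) ->
  P.-integrable [set: T] (fun w => (V w ^+ 2)%:E) ->
  (\int[mu]_x `|\int[P]_w (bias_integrand s (x - V w) (X w))%:E| <=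
   \int[mu]_t `|bias_defect P X s t|)%E.
Proof.
move=> XV iX iV.
have mk : measurable_fun [set: R] (bias_defect P X s) by exact: measurable_bias_defect.
have mka : measurable_fun [set: R] (fun t => `|bias_defect P X s t|%E) by exact: measurableT_comp.
have mk2 : measurable_fun [set: (measurableTypeR R * T)%type]
    (fun z => `|bias_defect P X s (z.1 - V z.2)|%E).
  apply: (measurableT_comp mka); apply: measurable_funB => //.
  exact: measurableT_comp.
have k0 (z : R * T) : (0 <= `|bias_defect P X s (z.1 - V z.2)|)%E by exact: abse_ge0.
have -> : (\int[mu]_t `|bias_defect P X s t| =
    \int[P]_v \int[mu]_x `|bias_defect P X s (x - V v)%R|)%E.
  under [RHS]eq_integral do rewrite (ge0_integral_translation _ mka)//.
  by rewrite integral_cst// [X in (_ * X)%E](_ : _ = 1%E) ?mule1//; exact: probability_setT.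
rewrite -(fubini_tonelli (m1 := mu) (m2 := P) _ mk2 k0)/=.
apply: ge0_le_integral => //.
- by apply: measurableT_comp => //; exact: measurable_shifted.
- exact: (measurable_fun_fubini_tonelli_F (m2 := P) _ mk2 k0).
- move=> x _; rewrite bias_defect_translate//.
  apply: le_abse_integral => //; apply: (measurableT_comp mk).
  exact: measurable_funB.
Qed.

Lemma integrable_sqr_sum (I : Type) (r : seq I) (X : I -> {RV P >-> R}) :
  (forall i, P.-integrable [set: T] (fun w => (X i w ^+ 2)%:E)) ->
  P.-integrable [set: T] (fun w => ((\sum_(i <- r) X i w) ^+ 2)%:E).
Proof.
move=> iX; elim: r => [|i r ih].
  by under eq_fun do rewrite big_nil expr0n/=; exact: finite_measure_integrable_cst.
apply: (@integrable_le_sqr _ _ _ P (X i) (fun w => \sum_(i <- r) X i w) _ 0 2) => //.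
  apply: measurable_funX; under eq_fun do rewrite big_cons.
  by apply: measurable_funD => //; exact: measurable_sum.
move=> w; rewrite big_cons ger0_norm ?sqr_ge0// add0r.
by have := sqr_ge0 (X i w - \sum_(i <- r) X i w); nra.
Qed.

(** Since [x - V i - X i = x - W] for every [i], the summands share one indicator and one factor
    [x - W]. So the terms [s i] add up to 1 and the factors [X i] to [W]: the shifted integrands sum
    to that of [W]. A general finite index type covers both [n] identically distributed summands and
    the pair of a variable and a Gaussian. *)
Theorem L1dist_sum_Phi (I : finType) (X V : I -> {RV P >-> R}) (W : {RV P >-> R})
    (s : I -> R) (K : I -> \bar R) :
  (forall w, W w = \sum_i X i w) -> (forall i w, V i w = W w - X i w) ->
  (forall i, P.-integrable [set: T] (fun w => (X i w ^+ 2)%:E)) ->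
  (forall i, independent2 (X i) (V i)) -> \sum_i s i = 1 ->
  (forall i, \int[mu]_t `|bias_defect P (X i) (s i) t| <= K i)%E ->
  (L1dist (cdf W) (@Phi R) <= 2%:E * \sum_i K i)%E.
Proof.
move=> WE VE iX XV s1 hK.
have iW : P.-integrable [set: T] (fun w => (W w ^+ 2)%:E).
  by under eq_fun do rewrite WE; exact: integrable_sqr_sum.
have iV i : P.-integrable [set: T] (fun w => (V i w ^+ 2)%:E).
  apply: (@integrable_le_sqr _ _ _ P W (X i) _ 0 2) => //; first exact: measurable_funX.
  move=> w; rewrite VE ger0_norm ?sqr_ge0// add0r.
  by have := sqr_ge0 (W w + X i w); nra.
apply: (le_trans (L1dist_cdf_Phi iW)); apply: lee_wpmul2l => //.
apply: (@le_trans _ _ (\sum_i \int[mu]_x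
    `|\int[P]_w (bias_integrand (s i) (x - V i w) (X i w))%:E|))%E; last first.
  by apply: lee_sum => i _; apply: le_trans (hK i); exact: integral_bias_defect_translate_le.
rewrite -ge0_integral_sum//; last first.
  by move=> i; apply: measurableT_comp => //; exact: measurable_shifted.
apply: ge0_le_integral => //.
- by apply: measurableT_comp => //; exact: measurable_bias_defect.
- by apply: emeasurable_sum => i _; apply: measurableT_comp => //; exact: measurable_shifted.
move=> x _; apply: le_trans (lee_abs_sum _ _ _).
rewrite le_eqVlt; apply/orP; left; apply/eqP; congr abse.
rewrite -integral_sum//; last by move=> i; exact: integrable_shifted.
apply: eq_integral => w _; rewrite sumEFin; congr EFin.
have e i : (X i w <= x - V i w) = (W w <= x).
  by rewrite VE lerBrDr addrC subrK.
rewrite /bias_integrand; under [RHS]eq_bigr do rewrite e.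
case: ifPn => _; last by rewrite big1.
rewrite big_split/= s1; congr (_ + _); rewrite [in LHS]WE mulr_suml.
by apply: eq_bigr => i _; rewrite VE; congr (_ * _); rewrite WE; ring.
Qed.

End sum_of_independent.

(** * Independence of one variable from the sum of the others *)

Section grouping.
Context d (T : measurableType d) (R : realType) (P : probability T R).

Let preimage_measurable (X : {RV P >-> R}) (A : set R) :
  measurable A -> measurable (X @^-1` A).
Proof. by move=> mA; rewrite -[X in measurable X]setTI; exact: measurable_funP. Qed.

(** The pair's law under [P] restricted to [E] and normalised is a measure that agrees with the
    product law on rectangles, hence everywhere. *)
Lemma independent_pair_event (S X : {RV P >-> R}) (E : set T) : measurable E ->
  (forall A B : set R, measurable A -> measurable B ->
    P (S @^-1` A `&` X @^-1` B `&` E) = P (S @^-1` A) * P (X @^-1` B) * P E)%E ->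
  forall C : set (R * R), measurable C ->
    P ((fun w => (S w, X w)) @^-1` C `&` E) =
    ((distribution P S \x distribution P X) C * P E)%E.
Proof.
move=> mE SXE C mC.
(* A null event cannot be normalised, but then both sides vanish. *)
have [PE0|PE0] := eqVneq (P E) 0%E.
  rewrite PE0 mule0; apply: subset_measure0 PE0 => //.
  apply: measurableI => //; rewrite -[X in measurable X]setTI.
  by apply: measurable_fun_pair => //.
have PEfin : P E \is a fin_num by exact: fin_num_measure.
have PEf : 0 < fine (P E) by rewrite fine_gt0// ltey_eq PEfin/= andbT lt0e PE0 measure_ge0.
have mSX : measurable_fun [set: T] (fun w => (S w, X w)) by exact: measurable_fun_pair.
pose SX : {mfun T >-> (R * R)%type} := mfun_Sub (mem_set mSX).
have c0 : 0 <= (fine (P E))^-1 by rewrite invr_ge0 ltW.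
pose m' := pushforward (mscale (NngNum c0) (mrestr P mE)) SX.
have E' : (distribution P S \x distribution P X)%E C = m' C.
  apply: product_measure_unique => // A B mA mB.
  rewrite /= /pushforward /mscale/= /mrestr.
  have -> : SX @^-1` (A `*` B) = S @^-1` A `&` X @^-1` B by [].
  rewrite SXE// muleC -muleA -[in X in (_ * X)%E](fineK PEfin) -EFinM.
  by rewrite divff ?mule1// gt_eqF.
rewrite E' /m' /pushforward /mscale/= /mrestr -[X in (_ * X)%E](fineK PEfin) muleAC -EFinM.
by rewrite mulVf ?mul1e// gt_eqF.
Qed.

(** Induction on the list of summed indices. The events indexed by [K] are carried along so that the
    next index [j] can join [K] in the induction hypothesis. This separates the partial sum, [X j]
    and the remaining events on rectangles, and [independent_pair_event] extends it to events about
    partial sum plus [X j]. *)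
Lemma independent_sum_event (I : finType) (X : I -> {RV P >-> R}) (r : seq I) :
  mutually_independent X -> uniq r ->
  forall (S : {RV P >-> R}), (forall w, S w = \sum_(j <- r) X j w) ->
  forall (K : {set I}) (A : set R) (B : I -> set R),
    (forall j, j \in r -> j \notin K) -> measurable A -> (forall k, measurable (B k)) ->
  P (S @^-1` A `&` \bigcap_(k in [set` K]) X k @^-1` B k) =
  (P (S @^-1` A) * \prod_(k in K) P (X k @^-1` B k))%E.
Proof.
move=> indX; elim: r => [_ S SE K A B _ mA mB|j r ih /= /andP[jr ur] S SE K A B jK mA mB].
  rewrite -indX//.
  have [A0|A0] := pselect (A 0).
    have -> : S @^-1` A = setT by apply/seteqP; split => w //= _; rewrite SE big_nil.
    by rewrite setTI probability_setT mul1e.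
  have -> : S @^-1` A = set0 by apply/seteqP; split => w //=; rewrite SE big_nil.
  by rewrite set0I measure0 mul0e.
have mSr : measurable_fun [set: T] (fun w => \sum_(j <- r) X j w).
  exact: measurable_sum.
pose Sr : {RV P >-> R} := mfun_Sub (mem_set mSr).
have {}ih := ih ur Sr (fun=> erefl).
have mC : measurable ((fun z : R * R => z.2 + z.1) @^-1` A).
  rewrite -[X in measurable X]setTI.
  have mf : measurable_fun [set: R * R] (fun z : R * R => z.2 + z.1) by exact: measurable_funD.
  exact: mf.
have jNK : j \notin K by apply: jK; rewrite mem_head.
(* Stated for subsets of [K] because it serves twice, for [K] itself and for the empty set. *)
have split_ind (K' : {set I}) (A' Bj : set R) : K' \subset K -> measurable A' -> measurable Bj ->
    P (Sr @^-1` A' `&` X j @^-1` Bj `&` \bigcap_(k in [set` K']) X k @^-1` B k) =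
    (P (Sr @^-1` A') * P (X j @^-1` Bj) * P (\bigcap_(k in [set` K']) X k @^-1` B k))%E.
  move=> K'K mA' mBj.
  have jNK' : j \notin K' by apply: contra jNK; exact: (fintype.subsetP K'K).
  (* As [j] is outside [K'], its slot is free to hold the set required of [X j]. *)
  pose B' k := if k == j then Bj else B k.
  have mB' k : measurable (B' k) by rewrite /B'; case: ifP.
  have -> : Sr @^-1` A' `&` X j @^-1` Bj `&` \bigcap_(k in [set` K']) X k @^-1` B k =
      Sr @^-1` A' `&` \bigcap_(k in [set` (j |: K')%SET]) X k @^-1` B' k.
    rewrite -setIA; congr (_ `&` _); apply/seteqP; split => w /=.
      move=> [XB h] k /=; rewrite in_setU1 /B'; case: eqP => [->//|_ /= kK]; exact: h.
    move=> h; split; first by have := h j; rewrite /= setU11 /B' eqxx; exact.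
    move=> k /= kK; have := h k; rewrite /= in_setU1 kK orbT /B'.
    by case: eqP => [kj|_]; [move: kK; rewrite kj (negbTE jNK')|exact].
  rewrite ih//; last first.
    move=> i ir; rewrite in_setU1 negb_or; apply/andP; split.
      by apply: contraNneq jr => <-.
    by apply: contra (jK i _); [exact: (fintype.subsetP K'K)|rewrite in_cons ir orbT].
  rewrite big_setU1//= /B' eqxx -muleA; congr (_ * (_ * _))%E.
  rewrite indX//; apply: eq_bigr => k kK.
  by case: eqP => // kj; move: kK; rewrite kj (negbTE jNK').
have mE (K' : {set I}) : measurable (\bigcap_(k in [set` K']) X k @^-1` B k).
  by apply: fin_bigcap_measurable => // k _; exact: preimage_measurable.
have SC : S @^-1` A = (fun w => (Sr w, X j w)) @^-1` ((fun z : R * R => z.2 + z.1) @^-1` A).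
  by apply/seteqP; split => w; rewrite /= SE big_cons.
rewrite SC (independent_pair_event (mE K))//; last by move=> *; exact: split_ind.
rewrite -indX//; congr (_ * _)%E.
(* With [E = setT] the same lemma identifies the product measure of the event with the probability
   that [S] lies in [A]. *)
have := @independent_pair_event Sr (X j) setT measurableT _ _ mC.
rewrite setIT probability_setT mule1 => -> // A' B'' mA' mB''.
have := @split_ind finset.set0 A' B'' (finset.sub0set _) mA' mB''.
have -> : [set` (finset.set0 : {set I})] = set0 :> set I.
  by apply/seteqP; split => k //=; rewrite inE.
by rewrite bigcap_set0 setIT probability_setT mule1.
Qed.

Lemma mutually_independent_sum_others (I : finType) (X V : I -> {RV P >-> R}) :
  mutually_independent X -> (forall i w, V i w = \sum_(j | j != i) X j w) ->
  forall i, independent2 (X i) (V i).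
Proof.
move=> indX VE i A B mA mB.
have := @independent_sum_event I X [seq j <- index_enum I | j != i] indX
  (filter_uniq _ (index_enum_uniq _)) (V i) _ [set i]%SET B (fun=> A).
rewrite big_set1 (_ : [set` [set i]%SET] = [set i]); last first.
  by apply/seteqP; split => k /=; rewrite inE => /eqP.
rewrite bigcap_set1 setIC muleC; apply => //.
- by move=> w; rewrite VE big_filter.
- by move=> j; rewrite mem_filter inE => /andP[].
Qed.

Lemma mutually_independent_comp (I : finType) (X Y : I -> {RV P >-> R}) (f : R -> R) :
  measurable_fun [set: R] f -> (forall i w, Y i w = f (X i w)) ->
  mutually_independent X -> mutually_independent Y.
Proof.
move=> mf YE indX J A mA.
have E i : Y i @^-1` A i = X i @^-1` (f @^-1` A i).
  by apply/seteqP; split => w; rewrite /= YE.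
under eq_bigcapr do rewrite E.
under eq_bigr do rewrite E.
apply: indX => i; rewrite -[X in measurable X]setTI; exact: mf.
Qed.

End grouping.

(** * Gaussian variables *)

Section density.
Context d (T : measurableType d) (R : realType).
Variables (mu nu : {measure set T -> \bar R}) (g : T -> R).
Hypotheses (mg : measurable_fun [set: T] g) (g0 : forall x, 0 <= g x).
Hypothesis nuE : forall A, measurable A -> nu A = (\int[mu]_(x in A) (g x)%:E)%E.
Import HBNNSimple.

Let integral_density_nnsfun (h : {nnsfun T >-> R}) :
  (\int[nu]_x (h x)%:E = \int[mu]_x ((h x)%:E * (g x)%:E))%E.
Proof.
under [LHS]eq_integral do rewrite fimfunE -fsumEFin//.
rewrite [LHS]ge0_integral_fsum//; last 2 first.
  - by move=> r; exact/measurable_EFinP/measurableT_comp.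
  - by move=> n x _; rewrite EFinM nnfun_muleindic_ge0.
under [RHS]eq_integral.
  move=> x xD; rewrite fimfunE -fsumEFin// ge0_mule_fsuml; last first.
    by move=> r; rewrite EFinM nnfun_muleindic_ge0.
  over.
rewrite [RHS]ge0_integral_fsum//; last 2 first.
  - move=> r; apply: emeasurable_funM; last exact/measurable_EFinP.
    by apply/measurable_EFinP; do 2 apply/measurableT_comp => //.
  - move=> n x _; apply: mule_ge0; last by rewrite lee_fin.
    by rewrite EFinM nnfun_muleindic_ge0.
apply: eq_fsbigr => r _; rewrite integralZl_indic_nnsfun//= integral_indic// setIT nuE//.
have [r0|r0] := leP 0 r.
  rewrite -ge0_integralZl//; last 2 first.
  - exact/measurable_EFinP/measurable_funTS.
  - by move=> x _; rewrite lee_fin.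
  rewrite integral_mkcond; apply: eq_integral => x _; rewrite patchE indicE.
  by case: ifPn => _; rewrite ?mulr1 ?mulr0 ?mul0e.
have -> : h @^-1` [set r] = set0.
  apply/seteqP; split => x //= hxr; have : 0 <= h x by []; rewrite hxr leNgt r0//.
rewrite integral_set0 mule0; apply/esym; apply: integral0_eq => x _.
by rewrite indicE in_set0 mulr0 mul0e.
Qed.

(** Monotone limits of simple functions carry the density formula from sets to nonnegative
    functions. *)
Lemma ge0_integral_density (f : T -> \bar R) :
  measurable_fun [set: T] f -> (forall x, 0 <= f x)%E ->
  (\int[nu]_x f x = \int[mu]_x (f x * (g x)%:E))%E.
Proof.
move=> mf f0.
pose f_ := nnsfun_approx measurableT mf.
have mf_ n : measurable_fun [set: T] (fun x => (f_ n x)%:E) by exact/measurable_EFinP.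
transitivity (limn (fun n => \int[nu]_x (f_ n x)%:E)%E).
  rewrite -monotone_convergence//=.
  - apply: eq_integral => ? _; apply/esym/cvg_lim => //=.
    exact: cvg_nnsfun_approx.
  - by move=> n ? _; rewrite lee_fin.
  - by move=> ? _ ? ? mn; rewrite lee_fin; exact/lefP/nd_nnsfun_approx.
under eq_fun do rewrite integral_density_nnsfun.
rewrite -monotone_convergence//=.
- apply: eq_integral => x _; apply/cvg_lim => //.
  by apply: cvgeZr => //; exact: cvg_nnsfun_approx.
- by move=> n; apply: emeasurable_funM => //; exact/measurable_EFinP.
- by move=> n x _; rewrite mule_ge0 ?lee_fin.
- move=> x _ a b ab; rewrite lee_pmul ?lee_fin//; exact/lefP/nd_nnsfun_approx.
Qed.

End density.

Section normal_moments.
Context {R : realType} (s : R) (s0 : s != 0).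
Let mu := @lebesgue_measure R.
Local Notation phi := (normal_pdf 0 s).
Local Notation Q := (normal_tail s).

Let m1 (c : R) : measurable_fun [set: R] (fun z => (z - c) ^+ 2 * phi z).
Proof.
apply: measurable_funM; last exact: measurable_normal_pdf.
by apply: measurable_funX; exact: measurable_funB.
Qed.

(** The centre [a / 2] is the vertex of the parabola [z * (a - z)] that occurs in [bias_integrand].
    The density part of the primitive has the factor [z - a], so at the endpoint only the tail
    survives. *)
Lemma integral_normal_sqr_y (a : R) :
  (\int[mu]_(z in `[a, +oo[) ((z - a / 2) ^+ 2 * phi z)%:E =
   ((s ^+ 2 + a ^+ 2 / 4) * Q a)%:E)%E.
Proof.
pose F z := - (s ^+ 2 * ((z - a) * phi z)) - (s ^+ 2 + a ^+ 2 / 4) * Q z.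
have dF (z : R) : is_derive z (1 : R) F ((z - a / 2) ^+ 2 * phi z).
  have h1 := is_derive_normal_pdf s0 z; have h2 := is_derive_normal_tail s0 z.
  by apply: is_derive_eq; rewrite /GRing.scale/=; field; rewrite s0.
rewrite (@ge0_integral_primitive_y _ _ F a 0)//.
- by congr (_%:E); rewrite /F; ring.
- by move=> z _; rewrite mulr_ge0 ?sqr_ge0 ?normal_pdf_ge0.
- move=> z; apply: cvgM; last exact: continuous_normal_pdf0.
  by apply: (@continuous_comp _ _ _ (fun z => z - a / 2) (fun z => z ^+ 2));
    [apply: cvgB => //; exact: cvg_cst|exact: sqr_continuous].
- rewrite -[X in _ --> X](subr0 0); apply: cvgB; last first.
    by apply: cvg_mully0; exact: cvg_normal_taily.
  apply: cvg_oppy0; apply: cvg_mully0.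
  have -> : (fun z => (z - a) * phi z) = (fun z => z * phi z - a * phi z).
    by apply/funext => z; rewrite mulrBl.
  rewrite -[X in _ --> X](subr0 0); apply: cvgB; first exact: cvg_normal_pdfMy.
  by apply: cvg_mully0; exact: cvg_normal_pdfy.
Qed.

Lemma integral_normal_sqr_Ny (t : R) :
  (\int[mu]_(z in `]-oo, t]) ((z - t / 2) ^+ 2 * phi z)%:E =
   ((s ^+ 2 + t ^+ 2 / 4) * Q (- t))%:E)%E.
Proof.
rewrite -{1}(opprK t) ge0_integration_by_substitutionNy.
- rewrite -[in RHS](sqrrN t) -integral_normal_sqr_y; apply: eq_integral => z _ /=.
  by congr (_%:E); rewrite normal_pdfN//; congr (_ * _); ring.
- apply: continuous_subspaceT => z; apply: cvgM; last exact: continuous_normal_pdf0.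
  by apply: (@continuous_comp _ _ _ (fun z => z - t / 2) (fun z => z ^+ 2));
    [apply: cvgB => //; exact: cvg_cst|exact: sqr_continuous].
- by move=> z _; rewrite mulr_ge0 ?sqr_ge0 ?normal_pdf_ge0.
Qed.

Lemma integral_normal_sqr :
  (\int[mu]_z (z ^+ 2 * phi z)%:E = (s ^+ 2)%:E)%E.
Proof.
have m0 : measurable_fun [set: R] (fun z => (z ^+ 2 * phi z)%:E).
  by apply/measurable_EFinP; apply: measurable_funM; last exact: measurable_normal_pdf.
have e (a : R) z : (z ^+ 2 * phi z) = ((z - 0 / 2) ^+ 2 * phi z) by rewrite mul0r subr0.
rewrite -(setUv `]-oo, 0]%classic) ge0_integral_setU//=; last 4 first.
- exact: measurableC.
- exact: measurable_funTS.
- by move=> z _; rewrite lee_fin mulr_ge0 ?sqr_ge0 ?normal_pdf_ge0.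
- by apply/disj_set2P; rewrite setICr.
rewrite setCitvl integral_itv_obnd_cbnd; last exact: measurable_funTS.
under eq_integral do rewrite (e 0).
rewrite integral_normal_sqr_Ny; under eq_integral do rewrite (e 0).
rewrite integral_normal_sqr_y -EFinD; congr EFin.
by rewrite normal_tailN//; field.
Qed.

End normal_moments.

(* [lebesgue_measure] lives on [measurableTypeR R] and the laws of random
   variables on [R]: the two measurable structures have the same measurable sets
   but different displays. *)
Lemma ge0_integral_lawT d (T : measurableType d) (R : realType) (P : probability T R)
    (Z : {RV P >-> R}) (nu : {measure set (measurableTypeR R) -> \bar R})
    (f : R -> \bar R) :
  (forall A : set R, measurable A -> distribution P Z A = nu A) ->
  measurable_fun [set: R] f -> (forall x, 0 <= f x)%E ->
  (\int[P]_w f (Z w) = \int[nu]_z f z)%E.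
Proof.
move=> nuE mf f0; rewrite -integral_law//.
have mid : @measurable_fun _ _ (measurableTypeR R) R setT id.
  by move=> _ A mA; rewrite setTI.
pose idm := @mfun_Sub _ _ (measurableTypeR R) R id (mem_set mid).
rewrite (eq_measure_integral (pushforward nu idm)) => [|A mA _]; last exact: nuE.
by rewrite ge0_integral_pushforward.
Qed.

Section gaussian_bias.
Context d (T : measurableType d) (R : realType) (P : probability T R).
Variables (s : R) (Z : {RV P >-> R}).
Hypothesis lawZ : has_law Z (gaussian_law 0 s).
Let mu := @lebesgue_measure R.

Let integral_normal_law (f : R -> \bar R) : s != 0 ->
  measurable_fun [set: R] f -> (forall x, 0 <= f x)%E ->
  (\int[P]_w f (Z w) = \int[mu]_z (f z * (normal_pdf 0 s z)%:E))%E.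
Proof.
move=> s0 mf f0; rewrite (ge0_integral_lawT (nu := normal_prob 0 s))//; last first.
  by move=> A mA; rewrite lawZ// /gaussian_law (negbTE s0).
apply: (@ge0_integral_density _ _ _ mu (normal_prob 0 s) (normal_pdf 0 s)) => //.
- exact: measurable_normal_pdf.
- by move=> x; exact: normal_pdf_ge0.
Qed.

Let gaussian_law0 (f : R -> \bar R) : s = 0 -> measurable_fun [set: R] f ->
  (\int[P]_w f (Z w) = f 0%R)%E.
Proof.
move=> s0 mf; rewrite -integral_law//.
rewrite (eq_measure_integral (\d_(0 : R) : {measure set R -> \bar R})).
  by rewrite integral_dirac// diracT mul1e.
by move=> A mA _; have := lawZ mA; rewrite /gaussian_law s0 eqxx.
Qed.

Lemma gaussian_sqr_integrable : P.-integrable [set: T] (fun w => (Z w ^+ 2)%:E).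
Proof.
apply/integrableP; split; first by apply/measurable_EFinP; exact: measurable_funX.
under eq_integral do rewrite gee0_abs ?lee_fin ?sqr_ge0//.
have m2 : measurable_fun [set: R] (fun x : R => (x ^+ 2)%:E) by exact/measurable_EFinP.
have [s0|s0] := eqVneq s 0.
  by rewrite (gaussian_law0 (f := fun x => (x ^+ 2)%:E))// ltry.
rewrite (integral_normal_law (f := fun x => (x ^+ 2)%:E))//; last first.
  by move=> x; rewrite lee_fin sqr_ge0.
under eq_integral do rewrite -EFinM.
by rewrite integral_normal_sqr// ltry.
Qed.

(** The centered normal law is its own zero biased law. Completing the square writes the integrand
    as [A - B] with [A] and [B] nonnegative and of equal integral. For [s = 0] the law is the point
    mass at 0, where the integrand vanishes. *)
Lemma gaussian_bias_defect t : bias_defect P Z (s ^+ 2) t = 0%E.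
Proof.
have [s0|s0] := eqVneq s 0.
  rewrite /bias_defect (gaussian_law0 (f := fun x => (bias_integrand (s ^+ 2) t x)%:E))//.
    by rewrite /bias_integrand s0 expr0n/= mul0r addr0 if_same.
  by apply/measurable_EFinP; exact: measurable_bias_integrand.
(* On [z <= t], [s^2 + z (t - z) = (s^2 + t^2/4) - (z - t/2)^2]. *)
pose A z : R := if z <= t then s ^+ 2 + t ^+ 2 / 4 else 0.
pose B z : R := if z <= t then (z - t / 2) ^+ 2 else 0.
have c0 : 0 <= s ^+ 2 + t ^+ 2 / 4 by rewrite addr_ge0 ?divr_ge0 ?sqr_ge0.
have mA : measurable_fun [set: R] A by apply: measurable_fun_ifT => //; exact: measurable_fun_ler.
have mB : measurable_fun [set: R] B.
  apply: measurable_fun_ifT => //; first exact: measurable_fun_ler.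
  by apply: measurable_funX; exact: measurable_funB.
have A0 z : 0 <= A z by rewrite /A; case: ifP.
have B0 z : 0 <= B z by rewrite /B; case: ifP => // _; exact: sqr_ge0.
have iA : (\int[P]_w (A (Z w))%:E = ((s ^+ 2 + t ^+ 2 / 4) * normal_tail s (- t))%:E)%E.
  rewrite (integral_normal_law (f := fun x => (A x)%:E))//; last exact/measurable_EFinP.
  rewrite EFinM -normal_tailNE// -ge0_integralZl//; last 2 first.
  - exact: measurable_normal_pdf_EFin.
  - by move=> y _; rewrite lee_fin normal_pdf_ge0.
  rewrite [RHS]integral_mkcond; apply: eq_integral => z _; rewrite patchE /A.
  case: ifPn => zt; first by rewrite mem_set//= in_itv.
  by rewrite memNset ?mul0e//= in_itv/=; exact/negP.
have iB : (\int[P]_w (B (Z w))%:E = ((s ^+ 2 + t ^+ 2 / 4) * normal_tail s (- t))%:E)%E.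
  rewrite (integral_normal_law (f := fun x => (B x)%:E))//; last exact/measurable_EFinP.
  rewrite -integral_normal_sqr_Ny// [RHS]integral_mkcond; apply: eq_integral => z _.
  rewrite patchE /B; case: ifPn => zt; first by rewrite mem_set ?EFinM//= in_itv.
  by rewrite memNset ?mul0e//= in_itv/=; exact/negP.
have int_ge0 (f : R -> R) c : measurable_fun [set: R] f -> (forall x, 0 <= f x) ->
    (\int[P]_w (f (Z w))%:E = c%:E)%E -> P.-integrable [set: T] (EFin \o (fun w => f (Z w))).
  move=> mf f0 fc; apply/integrableP; split.
    by apply/measurable_EFinP; exact: measurableT_comp.
  by under eq_integral do rewrite /= ger0_norm//; rewrite fc ltry.
rewrite /bias_defect.
under eq_integral => w _.
  rewrite (_ : bias_integrand _ _ _ = A (Z w) - B (Z w)); last first.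
    by rewrite /bias_integrand /A /B; case: ifP => _; [field|rewrite subr0].
  rewrite EFinB.
  over.
rewrite integralB//; last 2 first.
- exact: int_ge0 iA.
- exact: int_ge0 iB.
by rewrite iA iB subee.
Qed.

End gaussian_bias.

(** * Zero biased variables *)

Lemma lipschitz_abs_continuous (R : realType) (f : R -> R) :
  (forall x y, `|f x - f y| <= `|x - y|) -> abs_continuous f.
Proof.
move=> lf a b e e0; exists e => // n u v uv _ uvd.
apply: le_lt_trans uvd; apply: ler_sum => i _.
have [_ [uvi _]] := uv i.
by rewrite (le_trans (lf _ _))// ger0_norm// subr_ge0.
Qed.

Section hinge.
Context {R : realType} (t : R).

(** The test function for zero biasing: one side of its identity is [E[X (t - X)^+]], the other a
    value of the distribution of [Xs]. *)
Definition hinge (x : R) : R := Num.max (t - x) 0.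

Lemma hingeE x : hinge x = if x <= t then t - x else 0.
Proof. by rewrite /hinge -(subr_ge0 x); case: leP. Qed.

Lemma hinge_lipschitz x y : `|hinge x - hinge y| <= `|x - y|.
Proof.
have := ler_norm (x - y); have := ler_norm (y - x); rewrite (distrC y) => h1 h2.
rewrite ler_norml !hingeE; case: (leP x t) => xt; case: (leP y t) => yt;
  apply/andP; split; lra.
Qed.

(* At the kink the left and right difference quotients are [-1] and [0], so the
   limit does not exist and [lim] returns its default value [0]. *)
Lemma derive1_hinge x : hinge^`()%classic x = if x < t then -1 else 0.
Proof.
case: ltgtP => [xt|tx|->].
- rewrite derive1E (@near_eq_derive _ _ _ _ (fun y => t - y)).
    by rewrite derive_val; ring.
  near=> y; rewrite hingeE ifT//; near: y.
  by apply: filterS (lt_nbhsl xt) => y /ltW.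
- rewrite derive1E (@near_eq_derive _ _ _ _ (cst 0)); first by rewrite derive_val.
  near=> y; rewrite hingeE leNgt ifF//; apply/negbTE; rewrite negbK; near: y.
  exact: lt_nbhsr.
- apply: dvgP => /cvg_ex[l hl].
  have hr := cvg_dnbhs_at_right hl; have hL := cvg_dnbhs_at_left hl.
  have lr : l = 0.
    apply: (cvg_unique _ hr) => //.
    apply: cvg_near_cst; near=> h.
    have h0 : 0 < h by near: h; exact: nbhs_right_gt.
    by rewrite !hingeE lexx subrr subr0 ifF ?scaler0//; apply/negbTE; rewrite -ltNge ltrDr.
  have ll : l = -1.
    apply: (cvg_unique _ hL) => //.
    apply: cvg_near_cst; near=> h.
    have h0 : h < 0 by near: h; exact: nbhs_left_lt.
    rewrite !hingeE lexx subrr subr0 ifT; last by rewrite gerDr ltW.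
    by rewrite /GRing.scale/=; field; rewrite lt_eqF.
  by move: ll; rewrite lr; lra.
Unshelve. all: by end_near. Qed.

End hinge.
Section zero_biased_defect.
Context d (T : measurableType d) (R : realType) (P : probability T R).
Context d' (T' : measurableType d') (P' : probability T' R).
Variables (X : {RV P >-> R}) (Xs : {RV P' >-> R}) (v : R).
Hypotheses (EX : 'E_P[X]%E = 0%E) (VX : 'V_P[X] = v%:E).

Lemma centered_sqr_integrable : P.-integrable [set: T] (fun w => (X w ^+ 2)%:E).
Proof.
apply/integrableP; split; first by apply/measurable_EFinP; exact: measurable_funX.
under eq_integral do rewrite gee0_abs ?lee_fin ?sqr_ge0//.
move: VX; rewrite /variance covariance.unlock EX unlock/= => VXE.
rewrite (_ : (\int[P]_w _)%E = v%:E) ?ltry// -VXE.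
by apply: eq_integral => w _; rewrite !fctE/= subr0 expr2.
Qed.

Hypothesis zb : zero_biased X Xs.

(** The derivative of [hinge t] is -1 strictly to the left of [t] and 0 at the kink, so the zero
    bias identity yields the probability of [Xs < t]. The [pmf] term restores the possible atom at
    [t]. *)
Lemma zero_biased_bias_defect t : bias_defect P X v t =
  (v%:E * (cdf X t - cdf Xs t + (pmf Xs t)%:E))%E.
Proof.
have iX := centered_sqr_integrable.
have mlt : measurable (Xs @^-1` `]-oo, t[).
  by rewrite -[X in measurable X]setTI; exact: measurable_funP.
have dE : (fun w => ((hinge t)^`()%classic (Xs w))%:E) =
    (fun w => (- \1_(Xs @^-1` `]-oo, t[) w)%:E).
  apply/funext => w; rewrite derive1_hinge indicE; case: ifPn => h.
    by rewrite mem_set//= in_itv.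
  by rewrite memNset ?oppr0//= in_itv/=; exact/negP.
have fE : (fun w => (X w * hinge t (X w))%:E) = (fun w => (bias_integrand 0 t (X w))%:E).
  apply/funext => w; rewrite hingeE /bias_integrand; case: ifP => _; congr EFin; ring.
have id : P'.-integrable [set: T'] (fun w => (- \1_(Xs @^-1` `]-oo, t[) w)%:E).
  by under eq_fun do rewrite EFinN; apply: integrableN; exact: integrable_indic.
have := @zb (hinge t) (lipschitz_abs_continuous (hinge_lipschitz t)).
rewrite dE fE => /(_ (integrable_bias_integrand _ _ _ iX) id).
rewrite VX unlock fE dE bias_defect_cdf// /bias_defect => ->//.
have -> : (\int[P']_w (- \1_(Xs @^-1` `]-oo, t[) w)%:E = - (P' (Xs @^-1` `]-oo, t[)))%E.
  under eq_integral do rewrite EFinN.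
  by rewrite integralN ?integral_indic ?setIT//; exact/integrable_add_def/integrable_indic.
have -> : cdf Xs t = (P' (Xs @^-1` `]-oo, t[) + (pmf Xs t)%:E)%E.
  rewrite /cdf /distribution /pushforward /pmf fineK ?fin_num_measure//.
    rewrite -measureU//.
    - by congr (P' _); apply/seteqP; split => w /=; rewrite !in_itv/= le_eqVlt;
        [case/predU1P; [right|left]|case=> ->; rewrite ?eqxx ?orbT].
    - by apply/seteqP; split => w //=; rewrite in_itv/= => -[/[swap] ->]; rewrite ltxx.
have : cdf X t \is a fin_num by exact: fin_num_measure.
have : P' (Xs @^-1` `]-oo, t[) \is a fin_num by exact: fin_num_measure.
case: (P' _) => // a _; case: (cdf X t) => // c _.
rewrite -?EFinN -?EFinM -?EFinD.
by congr EFin; ring.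
Qed.

(** The [pmf] of [Xs] has Lebesgue integral 0, so it may be added on the right. The comparison then
    holds at every [t], atoms included. *)
Lemma integral_zero_biased_defect_le : 0 <= v ->
  (\int[lebesgue_measure]_t `|bias_defect P X v t| <= v%:E * L1dist (cdf Xs) (cdf X))%E.
Proof.
move=> v0.
have mcX := cdf_measurable X; have mcXs := cdf_measurable Xs.
have mD : measurable_fun [set: R] (fun t => `|cdf Xs t - cdf X t|)%E.
  by apply: measurableT_comp => //; exact: emeasurable_funB.
have mp : measurable_fun [set: R] (fun t => (pmf Xs t)%:E).
  by apply/measurable_EFinP; exact: pmf_measurable.
have -> : (v%:E * L1dist (cdf Xs) (cdf X) =
    \int[lebesgue_measure]_t (v%:E * (`|cdf Xs t - cdf X t| + (pmf Xs t)%:E)))%E.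
  rewrite ge0_integralZl//; last 2 first.
  - exact: emeasurable_funD.
  - by move=> t _; rewrite adde_ge0 ?abse_ge0 ?lee_fin ?pmf_ge0.
  rewrite ge0_integralD// ?lebesgue_integral_pmf ?adde0//.
  by move=> t _; rewrite lee_fin pmf_ge0.
apply: ge0_le_integral => //.
- by apply: measurableT_comp => //; exact: measurable_bias_defect.
- by apply: measurable_funeM; exact: emeasurable_funD.
move=> t _; rewrite zero_biased_bias_defect abseM gee0_abs ?lee_fin//.
apply: lee_wpmul2l; first by rewrite lee_fin.
rewrite (le_trans (lee_abs_add _ _))// [X in (_ + X)%E]gee0_abs ?lee_fin ?pmf_ge0//.
by rewrite leeD2r// -abseN fin_num_oppeB ?fin_num_measure// addeC.
Qed.

End zero_biased_defect.

Theorem gaussian_sum_L1dist (R : realType) (d : measure_display) (T : measurableType d)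
    (P : probability T R) (d' : measure_display) (T' : measurableType d')
    (P' : probability T' R) (s1 s2 : R) (X Z W : {RV P >-> R}) (Xs : {RV P' >-> R}) :
  'E_P[X]%E = 0%E -> 'V_P[X] = (s1 ^+ 2)%:E ->
  has_law Z (gaussian_law 0 s2) -> independent2 X Z ->
  s1 ^+ 2 + s2 ^+ 2 = 1 -> (forall w, W w = X w + Z w) -> zero_biased X Xs ->
  (L1dist (cdf W) (@Phi R) <= (2 * s1 ^+ 2)%:E * L1dist (cdf Xs) (cdf X))%E.
Proof.
move=> EX VX lawZ XZ s12 WE zb.
have ZX : independent2 Z X by move=> A B mA mB; rewrite setIC XZ// muleC.
(* Two summands indexed by [bool]: each is the complement of the other, and the Gaussian one has
   bound 0. *)
have := @L1dist_sum_Phi _ _ _ P bool (fun b => if b then X else Z)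
  (fun b => if b then Z else X) W (fun b => if b then s1 ^+ 2 else s2 ^+ 2)
  (fun b => if b then (s1 ^+ 2)%:E * L1dist (cdf Xs) (cdf X) else 0)%E.
rewrite !big_bool/= adde0 EFinM muleA; apply.
- by move=> w; rewrite big_bool/= WE.
- by case=> w; rewrite WE; ring.
- by case; [exact: centered_sqr_integrable VX|exact: gaussian_sqr_integrable lawZ].
- by case.
- by [].
- case; first exact: integral_zero_biased_defect_le (sqr_ge0 _).
  rewrite le_eqVlt; apply/orP; left; apply/eqP; apply: integral0_eq => t _.
  by rewrite (gaussian_bias_defect lawZ) abse0.
Qed.

(** * Bernoulli and uniform summands *)

Section piecewise_itv.
Context {R : realType}.
Let mu := @lebesgue_measure R.

Lemma integral_itv_primitive (a b : R) (f F : R -> R) : a <= b -> continuous f ->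
  (forall x, is_derive x (1 : R) F (f x)) ->
  (\int[mu]_(x in `[a, b]) (f x)%:E = (F b - F a)%:E)%E.
Proof.
rewrite le_eqVlt => /predU1P[->|ab] cf dF; first by rewrite set_itv1 integral_set1 subrr.
rewrite EFinB -(@continuous_FTC2 R f F)//.
- exact: continuous_subspaceT.
- split.
  + by move=> x _; have [] := dF x.
  + exact: cvg_at_right_filter (is_derive_continuous (dF a)).
  + exact: cvg_at_left_filter (is_derive_continuous (dF b)).
- by move=> x _; rewrite derive1E; have [] := dF x.
Qed.

Lemma integral_itv_piecewise (a m b : R) (f f1 f2 F1 F2 : R -> R) : a < m -> m < b ->
  measurable_fun [set: R] f -> (forall x, a <= x -> x <= b -> 0 <= f x) ->
  (forall x, x <= m -> f x = f1 x) -> (forall x, m <= x -> f x = f2 x) ->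
  continuous f1 -> continuous f2 ->
  (forall x, is_derive x (1 : R) F1 (f1 x)) -> (forall x, is_derive x (1 : R) F2 (f2 x)) ->
  (\int[mu]_(x in `[a, b]) (f x)%:E = (F1 m - F1 a + (F2 b - F2 m))%:E)%E.
Proof.
move=> am mb mf f0 ff1 ff2 cf1 cf2 dF1 dF2.
have mfD (D : set R) : measurable_fun D (fun x => (f x)%:E).
  by apply/measurable_EFinP; apply: measurable_funTS.
rewrite (@itv_bndbnd_setU _ _ _ (BRight m)) ?bnd_simp ?ltW//.
rewrite ge0_integral_setU//; last 3 first.
- exact: mfD.
- move=> x /= H; rewrite lee_fin; apply: f0; case: H; rewrite /= in_itv/= => /andP[h1 h2]//.
  + exact: ltW (lt_trans am h1).
  + exact: le_trans h2 (ltW mb).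
- apply/disj_set2P; apply/seteqP; split => x //=; rewrite !in_itv/=.
  by move=> [/andP[_ xt] /andP[tx _]]; move: (le_lt_trans xt tx); rewrite ltxx.
rewrite integral_itv_obnd_cbnd; last exact: mfD.
rewrite EFinD; congr (_ + _)%E.
- rewrite -(integral_itv_primitive (ltW am) cf1 dF1); apply: eq_integral => x.
  by rewrite inE/= in_itv/= => /andP[_ xm]; rewrite ff1.
- rewrite -(integral_itv_primitive (ltW mb) cf2 dF2); apply: eq_integral => x.
  by rewrite inE/= in_itv/= => /andP[mx _]; rewrite ff2.
Qed.

Lemma le_integral_itv (a b : R) (f g : R -> R) :
  measurable_fun [set: R] f -> measurable_fun [set: R] g ->
  (forall x, a <= x -> x <= b -> `|f x| <= g x) ->
  (forall x, (x < a) || (b < x) -> f x = 0) ->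
  (\int[mu]_x `|(f x)%:E| <= \int[mu]_(x in `[a, b]) (g x)%:E)%E.
Proof.
move=> mf mg fg f0; rewrite [leRHS]integral_mkcond; apply: ge0_le_integral => //.
- by apply: measurableT_comp => //; exact/measurable_EFinP.
- by apply/(measurable_restrictT _ _).1 => //; apply/measurable_EFinP; apply: measurable_funTS.
- move=> x _; rewrite patchE; case: ifPn => xab.
    by move: xab; rewrite inE/= in_itv/= => /andP[ax xb]; rewrite lee_fin fg.
  rewrite f0 ?abse0//; apply: contraNT xab; rewrite negb_or -!leNgt => /andP[ax xb].
  by rewrite inE/= in_itv/= ax xb.
Qed.

End piecewise_itv.

Section iid_sum.
Context d (T : measurableType d) (R : realType) (P : probability T R).

(** The function [g] performs centering and scaling, the factor [n^(-1/2)] included, so that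
    independence and laws are only assumed of the raw variables. Each summand carries the weight
    [1 / n]. *)
Theorem L1dist_iid_sum_Phi (n : nat) (B : 'I_n -> {RV P >-> R}) (g : R -> R)
    (W : {RV P >-> R}) (K : R) :
  (0 < n)%N -> measurable_fun [set: R] g -> mutually_independent B ->
  (forall w, W w = \sum_i g (B i w)) ->
  (forall i, P.-integrable [set: T] (fun w => (g (B i w) ^+ 2)%:E)) ->
  (forall i, \int[lebesgue_measure]_t
    `|bias_defect P (fun w => g (B i w)) n%:R^-1 t| <= K%:E)%E ->
  (L1dist (cdf W) (@Phi R) <= (2 * (n%:R * K))%:E)%E.
Proof.
move=> n0 mg indB WE iY hK.
have mY i : measurable_fun [set: T] (fun w => g (B i w)) by exact: measurableT_comp.
pose Y i : {RV P >-> R} := mfun_Sub (mem_set (mY i)).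
have mV i : measurable_fun [set: T] (fun w => W w - Y i w) by exact: measurable_funB.
pose V i : {RV P >-> R} := mfun_Sub (mem_set (mV i)).
have indY : mutually_independent Y by exact: (mutually_independent_comp mg _ indB).
have sK : (\sum_(i < n) K%:E = (n%:R * K)%:E)%E.
  by rewrite sumEFin sumr_const card_ord mulr_natl.
rewrite EFinM -sK.
apply: (@L1dist_sum_Phi _ _ _ P 'I_n Y V W (fun=> n%:R^-1) (fun=> K%:E)) => //.
- apply: mutually_independent_sum_others => // i w.
  have -> : V i w = W w - g (B i w) by [].
  by rewrite WE (bigD1 i)//= addrAC subrr add0r.
- by rewrite sumr_const card_ord -[LHS]mulr_natl divff// pnatr_eq0 -lt0n.
Qed.

End iid_sum.

Section bernoulli_case.
Context d (T : measurableType d) (R : realType) (P : probability T R).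
Variables (p q : R) (B : {RV P >-> R}).
Hypotheses (p01 : 0 < p < 1) (qE : q = 1 - p) (lawB : has_law B (bernoulli_law p)).

Let ge0_integral_bernoulli_law (h : R -> R) : measurable_fun [set: R] h ->
  (forall x, 0 <= h x) ->
  (\int[P]_w (h (B w))%:E = (p * h 1 + q * h 0)%:E)%E.
Proof.
move=> mh h0.
have pp : 0 <= p <= 1 by case/andP: p01 => p0 p1; rewrite !ltW.
have mEh : measurable_fun [set: R] (EFin \o h) by exact/measurable_EFinP.
rewrite -(integral_law B mEh).
have mb : measurable_fun [set: bool] (fun b : bool => b%:R : R) by [].
pose b2r : {mfun bool >-> R} := mfun_Sub (mem_set mb).
rewrite (eq_measure_integral (pushforward (bernoulli_prob p) b2r)) => [|A mA _]; last exact: lawB.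
rewrite ge0_integral_pushforward//= ?preimage_setT ?integral_bernoulli_prob//=.
- by rewrite qE.
- by move=> b; rewrite lee_fin.
- by move=> x _; rewrite lee_fin.
Qed.

Lemma bernoulli_integrable (f : R -> R) : measurable_fun [set: R] f ->
  P.-integrable [set: T] (fun w => (f (B w))%:E).
Proof.
move=> mf; apply/integrableP; split; first by apply/measurable_EFinP; exact: measurableT_comp.
rewrite (ge0_integral_bernoulli_law (h := fun x => `|f x|)) ?ltry//.
exact: measurableT_comp.
Qed.

Lemma integral_bernoulli_law (f : R -> R) : measurable_fun [set: R] f ->
  (\int[P]_w (f (B w))%:E = (p * f 1 + q * f 0)%:E)%E.
Proof.
move=> mf.
have m1 : measurable_fun [set: R] (fun x => `|f x|) by exact: measurableT_comp.
have m2 : measurable_fun [set: R] (fun x => `|f x| + f x) by exact: measurable_funD.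
(* The decomposition [f = (|f| + f) - |f|] reduces to nonnegative functions. *)
have -> : (\int[P]_w (f (B w))%:E = \int[P]_w ((`|f (B w)| + f (B w))%:E - `|f (B w)|%:E))%E.
  by apply: eq_integral => w _; rewrite -EFinB addrC addKr.
rewrite integralB//; last 2 first.
- exact: (bernoulli_integrable m2).
- exact: (bernoulli_integrable m1).
rewrite (ge0_integral_bernoulli_law (h := fun x => `|f x| + f x))//; last first.
  by move=> x; rewrite -lerBlDr sub0r -normrN ler_norm.
rewrite (ge0_integral_bernoulli_law (h := fun x => `|f x|))// -EFinB.
by congr EFin; ring.
Qed.

Let p0 : 0 < p. Proof. by case/andP: p01. Qed.
Let q0 : 0 < q. Proof. by rewrite qE subr_gt0; case/andP: p01. Qed.

(** The zero biased law of a centered two-point law is uniform between the two points. So the defect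
    vanishes outside [[- c p, c q]] and is affine of slope [- p q c] inside, with its zero at
    [m = c (q - p)]. The distances from [m] to the endpoints are [c q] and [c p]; the two triangles
    have total area [c v (p^2 + q^2) / 2]. *)
Lemma integral_bernoulli_bias_defect (c v : R) : 0 < c -> v = c ^+ 2 * (p * q) ->
  (\int[lebesgue_measure]_t `|bias_defect P (fun w => (c * (B w - p))%R) v t| <=
   (c * v * (p ^+ 2 + q ^+ 2) / 2)%:E)%E.
Proof.
move=> c0 vE.
pose m := c * (q - p).
pose kap t := p * bias_integrand v t (c * q) + q * bias_integrand v t (- (c * p)).
have mk : measurable_fun [set: R] kap.
  by apply: measurable_funD; apply: measurable_funM => //; exact: measurable_bias_integrand.
have mlin : measurable_fun [set: R] (fun x => c * (x - p)).
  by apply: measurable_funM => //; exact: measurable_funB.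
have kapE t : bias_defect P (fun w => (c * (B w - p))%R) v t = (kap t)%:E.
  rewrite /bias_defect (integral_bernoulli_law (f := fun x => bias_integrand v t (c * (x - p)))).
    rewrite /kap; congr (_ * bias_integrand _ _ _ + _ * bias_integrand _ _ _)%:E;
      by rewrite ?qE; ring.
  exact: measurable_bias_integrand.
under eq_integral do rewrite kapE.
have cp : 0 < c * p by rewrite mulr_gt0.
have cq : 0 < c * q by rewrite mulr_gt0.
have am : - (c * p) < m by rewrite /m; lra.
have mb : m < c * q by rewrite /m; lra.
have pqc : 0 < p * q * c by rewrite !mulr_gt0.
have mn : measurable_fun [set: R] (fun t => p * q * c * `|t - m|).
  apply: measurable_funM => //; apply: measurableT_comp => //; exact: measurable_funB.
have e1 : p + q = 1 by rewrite qE; ring.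
have kap_r t : c * q <= t -> kap t = 0.
  move=> ct; rewrite /kap /bias_integrand ct (le_trans (ltW (lt_trans am mb)) ct) vE.
  by rewrite qE; ring.
have kap_m t : - (c * p) <= t -> t < c * q -> kap t = p * q * c * (m - t).
  move=> at_ tb; rewrite /kap /bias_integrand at_ leNgt tb /= vE /m qE; ring.
have kap_l t : t < - (c * p) -> kap t = 0.
  move=> ta; rewrite /kap /bias_integrand leNgt (lt_trans ta (lt_trans am mb))/=.
  by rewrite leNgt ta/=; ring.
apply: (@le_trans _ _ (\int[lebesgue_measure]_(t in `[(- (c * p))%R, (c * q)%R])
    (p * q * c * `|t - m|)%:E)%E).
  apply: le_integral_itv => // t.
  - move=> at_ tb; have [tb'|tb'] := ltP t (c * q).
      by rewrite kap_m// normrM gtr0_norm// distrC.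
    by rewrite kap_r// normr0; exact: mulr_ge0 (ltW pqc) (normr_ge0 _).
  - by case/orP => [/kap_l//|/ltW/kap_r].
have dF1 (x : R) : is_derive x (1 : R)
    (fun t => - (p * q * c * (t - m) ^+ 2 / 2)) (p * q * c * (m - x)).
  by apply: is_derive_eq; rewrite /GRing.scale/=; field.
have dF2 (x : R) : is_derive x (1 : R)
    (fun t => p * q * c * (t - m) ^+ 2 / 2) (p * q * c * (x - m)).
  by apply: is_derive_eq; rewrite /GRing.scale/=; field.
rewrite (@integral_itv_piecewise _ _ m _ _ _ _ _ _ am mb mn _ _ _ _ _ dF1 dF2).
- by rewrite lee_fin le_eqVlt; apply/orP; left; apply/eqP; rewrite vE /m qE; field.
- by move=> x _ _; exact: mulr_ge0 (ltW pqc) (normr_ge0 _).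
- by move=> x xm; rewrite ler0_norm ?subr_le0// opprB.
- by move=> x mx; rewrite ger0_norm ?subr_ge0.
- by move=> x; apply: cvgM; [exact: cvg_cst|apply: cvgB => //; exact: cvg_cst].
- by move=> x; apply: cvgM; [exact: cvg_cst|apply: cvgB => //; exact: cvg_cst].
Qed.

End bernoulli_case.

Section uniform_case.
Context d (T : measurableType d) (R : realType) (P : probability T R).
Variable U : {RV P >-> R}.
Hypothesis lawU : has_law U (uniform_prob (ltN_sqrt3 R)).
Local Notation r := (Num.sqrt 3 : R).

Let r0 : 0 < r. Proof. by rewrite sqrtr_gt0. Qed.
Let r2 : r ^+ 2 = 3. Proof. by rewrite sqr_sqrtr. Qed.

Lemma ge0_integral_uniform_law (h : R -> R) : measurable_fun [set: R] h ->
  (forall x, 0 <= h x) ->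
  (\int[P]_w (h (U w))%:E =
   ((2 * r)^-1)%:E * \int[lebesgue_measure]_(u in `[(- r)%R, r]) (h u)%:E)%E.
Proof.
move=> mh h0; have mEh : measurable_fun [set: R] (EFin \o h) by exact/measurable_EFinP.
have h0' x : (0 <= (EFin \o h) x)%E by rewrite lee_fin.
rewrite (ge0_integral_lawT (nu := uniform_prob (ltN_sqrt3 R)) lawU mEh h0').
rewrite integral_uniform//; congr (_%:E * _)%E; congr (_^-1); ring.
Qed.

(** The minimum accounts for thresholds beyond the right end of the support. *)
Lemma ge0_integral_uniform_law_le (h H : R -> R) (tau : R) : - r <= tau ->
  (forall x, 0 <= h x) -> continuous h -> (forall x, is_derive x (1 : R) H (h x)) ->
  (\int[P]_w (if U w <= tau then h (U w) else 0)%:E =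
   ((2 * r)^-1 * (H (Num.min tau r) - H (- r)))%:E)%E.
Proof.
move=> rt h0 ch dH.
have mh : measurable_fun [set: R] h by exact: continuous_measurable_fun.
rewrite (@ge0_integral_uniform_law (fun u => if u <= tau then h u else 0)); last 2 first.
- by apply: measurable_fun_ifT => //; exact: measurable_fun_ler.
- by move=> x; case: ifP.
have rm : - r <= Num.min tau r by rewrite le_min rt/= ltW// ltN_sqrt3.
rewrite EFinM -(integral_itv_primitive rm ch dH); congr (_ * _)%E.
rewrite integral_mkcond [RHS]integral_mkcond; apply: eq_integral => u _.
rewrite !patchE !mem_setE !in_itv/= le_min.
by case: (- r <= u); case: (u <= tau); case: (u <= r).
Qed.

Lemma uniform_sqr_integrable (c : R) :
  P.-integrable [set: T] (fun w => ((c * U w) ^+ 2)%:E).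
Proof.
apply/integrableP; split.
  by apply/measurable_EFinP; apply: measurable_funX; exact: measurable_funM.
under eq_integral do rewrite gee0_abs ?lee_fin ?sqr_ge0//.
have ch : continuous (fun x : R => (c * x) ^+ 2).
  move=> x; apply: (@continuous_comp _ _ _ (fun x => c * x) (fun x => x ^+ 2)).
    by apply: cvgM => //; exact: cvg_cst.
  exact: sqr_continuous.
rewrite (@ge0_integral_uniform_law (fun u => (c * u) ^+ 2)); last 2 first.
- exact: continuous_measurable_fun.
- by move=> x; exact: sqr_ge0.
have dF (x : R) : is_derive x (1 : R) (fun x => c ^+ 2 * x ^+ 3 / 3) ((c * x) ^+ 2).
  by apply: is_derive_eq; rewrite /GRing.scale/=; field.
by rewrite (integral_itv_primitive (ltW (ltN_sqrt3 R)) ch dF) -EFinM ltry.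
Qed.

Lemma uniform_third_moment :
  (\int[P]_w (`|U w| ^+ 3)%:E = (3 * r / 4)%:E)%E.
Proof.
have mh : measurable_fun [set: R] (fun x : R => `|x| ^+ 3).
  by apply: measurable_funX; exact: normr_measurable.
rewrite (@ge0_integral_uniform_law (fun u => `|u| ^+ 3))//.
have dF1 (x : R) : is_derive x (1 : R) (fun x => - (x ^+ 4 / 4)) (- x ^+ 3).
  by apply: is_derive_eq; rewrite /GRing.scale/=; field.
have dF2 (x : R) : is_derive x (1 : R) (fun x => x ^+ 4 / 4) (x ^+ 3).
  by apply: is_derive_eq; rewrite /GRing.scale/=; field.
have nr0 : - r < 0 by rewrite oppr_lt0.
have c3 : continuous (fun x : R => x ^+ 3) by exact: (@exprn_continuous R 3).
rewrite (@integral_itv_piecewise _ _ 0 _ _ _ _ _ _ nr0 r0 mh _ _ _ _ _ dF1 dF2)//.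
- rewrite -EFinM; congr EFin.
  have -> : 3 * r / 4 = r ^+ 2 * r / 4 by rewrite r2.
  by field; rewrite gt_eqF.
- by move=> x x0; rewrite ler0_norm//; ring.
- by move=> x x0; rewrite ger0_norm.
- by move=> x; apply: cvgN; exact: c3.
Qed.

(** The zero biased law of [U] has density [(3 - x^2) / (4 r)] on [[- r, r]]. Subtracting its
    distribution function from the uniform one and rescaling by [c] gives the cubic in [kap], which
    vanishes at both ends and changes sign at 0. Hence the norm is twice the integral over the right
    half. *)
Lemma integral_uniform_bias_defect (c : R) : 0 < c ->
  (\int[lebesgue_measure]_t `|bias_defect P (fun w => (c * U w)%R) (c ^+ 2) t| <=
   (3 * c ^+ 3 / (8 * r))%:E)%E.
Proof.
move=> c0.
pose kap t : R := if t < - (c * r) then 0 else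
  if t <= c * r then t * (t ^+ 2 - 3 * c ^+ 2) / (12 * r * c) else 0.
have kapE t : bias_defect P (fun w => (c * U w)%R) (c ^+ 2) t = (kap t)%:E.
  rewrite /kap; case: ltP => [tl|tl].
    have mb : measurable_fun [set: R] (fun u => bias_integrand (c ^+ 2) t (c * u)).
      by apply: measurable_bias_integrand => //; exact: measurable_funM.
    (* The integrand vanishes only when [U] lies in [[- r, r]], which holds almost surely but not
       for every outcome; hence the passage through the absolute value. *)
    have b0 : (\int[P]_w `|(bias_integrand (c ^+ 2) t (c * U w))%:E| = 0)%E.
      rewrite (@ge0_integral_uniform_law
        (fun u => `|bias_integrand (c ^+ 2) t (c * u)|))//; last first.
        exact: measurableT_comp.
      rewrite integral0_eq ?mule0// => u /=; rewrite in_itv/= => /andP[ru _].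
      rewrite /bias_integrand leNgt (lt_le_trans tl) ?normr0//.
      by rewrite -mulrN ler_pM2l.
    apply/eqP; rewrite -abse_eq0 eq_le abse_ge0 andbT -b0.
    apply: le_abse_integral => //; apply/measurable_EFinP.
    exact: (measurableT_comp mb).
  (* On [c u <= t], [c^2 + c u (t - c u) = (c^2 + t^2/4) - (c u - t/2)^2]: both
     terms are nonnegative. *)
  pose A (u : R) : R := c ^+ 2 + t ^+ 2 / 4.
  pose B u : R := (c * u - t / 2) ^+ 2.
  have dA (x : R) : is_derive x (1 : R) (fun x => (c ^+ 2 + t ^+ 2 / 4) * x) (A x).
    by apply: is_derive_eq; rewrite /GRing.scale/= /A; ring.
  have dB (x : R) : is_derive x (1 : R) (fun x => (c * x - t / 2) ^+ 3 / (3 * c)) (B x).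
    by apply: is_derive_eq; rewrite /GRing.scale/= /B; field; rewrite gt_eqF.
  have cA : continuous A by move=> x; exact: cvg_cst.
  have cB : continuous B.
    move=> x; apply: (@continuous_comp _ _ _ (fun x => c * x - t / 2) (fun x => x ^+ 2)).
      by apply: cvgB; [apply: cvgM => //; exact: cvg_cst|exact: cvg_cst].
    exact: sqr_continuous.
  have A0 x : 0 <= A x by rewrite addr_ge0 ?divr_ge0 ?sqr_ge0.
  have B0 x : 0 <= B x by exact: sqr_ge0.
  have rt : - r <= t / c by rewrite ler_pdivlMr// mulNr mulrC.
  have iA := ge0_integral_uniform_law_le rt A0 cA dA.
  have iB := ge0_integral_uniform_law_le rt B0 cB dB.
  have mif (h : R -> R) : continuous h ->
      measurable_fun [set: R] (fun u => if u <= t / c then h u else 0).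
    move=> ch; apply: measurable_fun_ifT => //; first exact: measurable_fun_ler.
    exact: continuous_measurable_fun.
  have int_ge0 (h : R -> R) K : continuous h -> (forall x, 0 <= h x) ->
      (\int[P]_w (if (U w <= t / c)%R then h (U w) else 0)%:E = K%:E)%E ->
      P.-integrable [set: T] (fun w => (if (U w <= t / c)%R then h (U w) else 0)%:E).
    move=> ch h0 hK; apply/integrableP; split.
      by apply/measurable_EFinP; exact: (measurableT_comp (mif _ ch)).
    apply: le_lt_trans (ltry K); rewrite -hK le_eqVlt; apply/orP; left; apply/eqP.
    by apply: eq_integral => w _; rewrite gee0_abs// lee_fin; case: ifP.
  rewrite /bias_defect.
  transitivity (\int[P]_w ((if (U w <= t / c)%R then A (U w) else 0)%:E -
     (if (U w <= t / c)%R then B (U w) else 0)%:E))%E.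
    apply: eq_integral => w _; rewrite -EFinB; congr EFin.
    rewrite /bias_integrand ler_pdivlMr// (mulrC c).
    by case: ifP => _; rewrite ?subr0// /A /B; field.
  rewrite integralB//; last 2 first.
  - exact: int_ge0 cA A0 iA.
  - exact: int_ge0 cB B0 iB.
  rewrite iA iB -EFinB; congr EFin; have r3 : r ^+ 3 = 3 * r by rewrite exprS r2 mulrC.
  (* To [field] the root [r] is a free variable, so its powers are reduced by [r ^+ 2 = 3]
     beforehand. *)
  have e1 : (c * - r - t / 2) ^+ 3 =
      - (3 * c ^+ 3 * r + 9 * c ^+ 2 * t / 2 + 3 * c * r * t ^+ 2 / 4 + t ^+ 3 / 8).
    transitivity (- (c ^+ 3 * r ^+ 3 + 3 * c ^+ 2 * r ^+ 2 * t / 2 +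
      3 * c * r * t ^+ 2 / 4 + t ^+ 3 / 8)); first by field.
    by rewrite r3 r2; field.
  have e2 : (c * r - t / 2) ^+ 3 =
      3 * c ^+ 3 * r - 9 * c ^+ 2 * t / 2 + 3 * c * r * t ^+ 2 / 4 - t ^+ 3 / 8.
    transitivity (c ^+ 3 * r ^+ 3 - 3 * c ^+ 2 * r ^+ 2 * t / 2 +
      3 * c * r * t ^+ 2 / 4 - t ^+ 3 / 8); first by field.
    by rewrite r3 r2; field.
  have [tr|tr] := leP t (c * r).
  - have -> : Num.min (t / c) r = t / c by apply/min_idPl; rewrite ler_pdivrMr// mulrC.
    by rewrite e1; field; rewrite !gt_eqF.
  - have -> : Num.min (t / c) r = r by apply/min_idPr; rewrite ler_pdivlMr// mulrC ltW.
    by rewrite e1 e2; field; rewrite !gt_eqF.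
have mk : measurable_fun [set: R] kap.
  apply: measurable_fun_ifT => //; first exact: measurable_fun_ltr.
  apply: measurable_fun_ifT => //; first exact: measurable_fun_ler.
  apply: measurable_funM => //; apply: measurable_funM => //; apply: measurable_funB => //.
under eq_integral do rewrite kapE.
have cr : 0 < c * r by rewrite mulr_gt0.
have ncr : - (c * r) < 0 by rewrite oppr_lt0.
have D0 : 0 < 12 * r * c by rewrite !mulr_gt0.
pose g t : R := `|t| * (3 * c ^+ 2 - t ^+ 2) / (12 * r * c).
have mg : measurable_fun [set: R] g.
  apply: measurable_funM => //; apply: measurable_funM; first exact: normr_measurable.
  by apply: measurable_funB.
have sq t : - (c * r) <= t -> t <= c * r -> t ^+ 2 <= 3 * c ^+ 2.
  move=> h1 h2; rewrite -r2 -exprMn mulrC; nra.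
have g0 t : - (c * r) <= t -> t <= c * r -> 0 <= g t.
  by move=> h1 h2; rewrite divr_ge0 ?(ltW D0)// mulr_ge0// subr_ge0 sq.
apply: (@le_trans _ _ (\int[lebesgue_measure]_(t in `[(- (c * r))%R, (c * r)%R]) (g t)%:E)%E).
  apply: le_integral_itv => // t.
  - move=> h1 h2; rewrite /kap ltNge h1/= h2 /g.
    rewrite normrM normrV ?unitfE ?gt_eqF// (gtr0_norm D0) normrM (ler0_norm (_ : _ - _ <= 0)).
      by rewrite opprB.
    by rewrite subr_le0 sq.
  - case/orP => h; first by rewrite /kap h.
    by rewrite /kap ltNge (ltW (lt_trans ncr (lt_trans cr h)))/= leNgt h.
pose G t : R := (3 * c ^+ 2 * t ^+ 2 / 2 - t ^+ 4 / 4) / (12 * r * c).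
have dG (x : R) : is_derive x (1 : R) G (x * (3 * c ^+ 2 - x ^+ 2) / (12 * r * c)).
  by apply: is_derive_eq; rewrite /GRing.scale/=; field; rewrite !gt_eqF.
have dG' (x : R) : is_derive x (1 : R) (fun x => - G x)
    (- (x * (3 * c ^+ 2 - x ^+ 2) / (12 * r * c))).
  by have h := dG x; apply: is_derive_eq.
have cG : continuous (fun x : R => x * (3 * c ^+ 2 - x ^+ 2) / (12 * r * c)).
  move=> x; apply: cvgM; last exact: cvg_cst; apply: cvgM => //.
  by apply: cvgB; [exact: cvg_cst|exact: sqr_continuous].
rewrite (@integral_itv_piecewise _ _ 0 _ _ _ _ _ _ ncr cr mg g0 _ _ _ _ dG' dG)//.
- rewrite lee_fin le_eqVlt; apply/orP; left; apply/eqP; rewrite /G.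
  have e4 : (c * r) ^+ 4 = 9 * c ^+ 4 by rewrite exprMn -[4%N]/(2 * 2)%N (exprM r) r2; ring.
  have e2 : (c * r) ^+ 2 = 3 * c ^+ 2 by rewrite exprMn r2; ring.
  rewrite -[4%N]/(2 * 2)%N (exprM (- _)) sqrrN -exprM e4 e2.
  by field; rewrite !gt_eqF.
- by move=> x x0; rewrite /g ler0_norm//; ring.
- by move=> x x0; rewrite /g ger0_norm.
- by move=> x; apply: cvgN; exact: cG.
Qed.

End uniform_case.

(** * Standardized binomial and uniform sums *)

Theorem binomial_L1dist (R : realType) (d : measure_display) (T : measurableType d)
    (P : probability T R) (n : nat) (p q : R) (B : 'I_n -> {RV P >-> R})
    (X : 'I_n -> T -> R) (W : {RV P >-> R}) :
  (0 < n)%N -> 0 < p < 1 -> q = 1 - p ->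
  (forall i, has_law (B i) (bernoulli_law p)) -> mutually_independent B ->
  (forall i w, X i w = (B i w - p) / Num.sqrt (p * q)) ->
  (forall w, W w = (Num.sqrt n%:R)^-1 * \sum_(i < n) X i w) ->
  (L1dist (cdf W) (@Phi R) <= ((p ^+ 2 + q ^+ 2) / Num.sqrt (n%:R * p * q))%:E)%E /\
  (forall i : 'I_n, ((p ^+ 2 + q ^+ 2) / Num.sqrt (n%:R * p * q))%:E =
    ('E_P[(fun w => `|X i w| ^+ 3)%R] * ((Num.sqrt n%:R)^-1)%:E)%E).
Proof.
move=> n0 p01 qE lawB indB XE WE.
have p0 : 0 < p by case/andP: p01.
have q0 : 0 < q by rewrite qE subr_gt0; case/andP: p01.
have pq0 : 0 < p * q by rewrite mulr_gt0.
have nR : 0 < n%:R :> R by rewrite ltr0n.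
set a : R := Num.sqrt (p * q); set b : R := Num.sqrt n%:R.
have a0 : 0 < a by rewrite sqrtr_gt0.
have b0 : 0 < b by rewrite sqrtr_gt0.
have a2 : a ^+ 2 = p * q by rewrite sqr_sqrtr// ltW.
have b2 : b ^+ 2 = n%:R by rewrite sqr_sqrtr// ltW.
have -> : Num.sqrt (n%:R * p * q) = b * a by rewrite -mulrA sqrtrM// ltW.
split; last first.
  move=> i; rewrite unlock.
  have mf : measurable_fun [set: R] (fun x => `|(x - p) / a| ^+ 3).
    apply: measurable_funX; apply: measurableT_comp => //.
    by apply: measurable_funM => //; exact: measurable_funB.
  under eq_integral do rewrite XE.
  rewrite (integral_bernoulli_law p01 qE (lawB i) mf) -EFinM; congr EFin.
  rewrite sub0r -qE mulNr normrN !ger0_norm ?divr_ge0 ?ltW//.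
  (* The third absolute moment is [p q (p^2 + q^2) / a^3]; writing [p q = a^2] cancels two of the
     three powers. *)
  transitivity (p * q * (p ^+ 2 + q ^+ 2) / (a ^+ 2 * a * b)).
    by rewrite a2; field; rewrite !gt_eqF.
  by field; rewrite !gt_eqF.
have c0 : 0 < (b * a)^-1 by rewrite invr_gt0 mulr_gt0.
pose g x : R := (b * a)^-1 * (x - p).
have mg : measurable_fun [set: R] g.
  by apply: measurable_funM => //; exact: measurable_funB.
have vE : n%:R^-1 = (b * a)^-1 ^+ 2 * (p * q).
  by rewrite -b2 -a2; field; rewrite !gt_eqF.
have iY i : P.-integrable [set: T] (fun w => (g (B i w) ^+ 2)%:E).
  by apply: (bernoulli_integrable p01 qE (lawB i) (f := fun x => g x ^+ 2)); exact: measurable_funX.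
have WgE w : W w = \sum_i g (B i w).
  rewrite WE mulr_sumr; apply: eq_bigr => i _; rewrite XE /g -/a -/b.
  by field; rewrite !gt_eqF.
apply: le_trans (L1dist_iid_sum_Phi n0 mg indB WgE iY
  (fun i => integral_bernoulli_bias_defect p01 qE (lawB i) c0 vE)) _.
rewrite lee_fin le_eqVlt; apply/orP; left; apply/eqP.
by field; rewrite !gt_eqF.
Qed.

Theorem uniform_sum_L1dist (R : realType) (d : measure_display) (T : measurableType d)
    (P : probability T R) (n : nat) (U : 'I_n -> {RV P >-> R}) (W : {RV P >-> R}) :
  (0 < n)%N -> (forall i, has_law (U i) (uniform_prob (ltN_sqrt3 R))) ->
  mutually_independent U ->
  (forall w, W w = (Num.sqrt n%:R)^-1 * \sum_(i < n) U i w) ->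
  (L1dist (cdf W) (@Phi R) <= (Num.sqrt 3 / (4 * Num.sqrt n%:R))%:E)%E /\
  (forall i : 'I_n, (Num.sqrt 3 / (4 * Num.sqrt n%:R))%:E =
    ('E_P[(fun w => `|U i w| ^+ 3)%R] * ((3 * Num.sqrt n%:R)^-1)%:E)%E).
Proof.
move=> n0 lawU indU WE.
have nR : 0 < n%:R :> R by rewrite ltr0n.
set b : R := Num.sqrt n%:R.
have b0 : 0 < b by rewrite sqrtr_gt0.
have b2 : b ^+ 2 = n%:R by rewrite sqr_sqrtr// ltW.
have r0 : 0 < Num.sqrt 3 :> R by rewrite sqrtr_gt0.
have r2 : Num.sqrt 3 ^+ 2 = 3 :> R by rewrite sqr_sqrtr.
split; last first.
  move=> i; rewrite unlock (uniform_third_moment (lawU i)) -EFinM; congr EFin.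
  by field; rewrite gt_eqF.
have c0 : 0 < b^-1 by rewrite invr_gt0.
pose g x : R := b^-1 * x.
have mg : measurable_fun [set: R] g by exact: measurable_funM.
have vE : n%:R^-1 = b^-1 ^+ 2 by rewrite -b2 exprVn.
have WgE w : W w = \sum_i g (U i w) by rewrite WE mulr_sumr.
have iY i : P.-integrable [set: T] (fun w => (g (U i w) ^+ 2)%:E).
  exact: uniform_sqr_integrable (lawU i) _.
have hK i := integral_uniform_bias_defect (lawU i) c0; rewrite -vE in hK.
apply: le_trans (L1dist_iid_sum_Phi n0 mg indU WgE iY hK) _.
rewrite lee_fin le_eqVlt; apply/orP; left; apply/eqP; rewrite -b2.
(* Two times [n] times the bound of one summand, with [n = b ^+ 2]; the remaining 3 is then read as
   the square of its root. *)
transitivity (3 / (4 * Num.sqrt 3 * b)); first by field; rewrite !gt_eqF.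
by rewrite -[X in X / _ = _]r2; field; rewrite !gt_eqF.
Qed.

Theorem corollary2p1 (R : realType) :
  (forall (d : measure_display) (T : measurableType d) (P : probability T R)
      (n : nat) (p q : R) (B : 'I_n -> {RV P >-> R}) (X : 'I_n -> T -> R)
      (W : {RV P >-> R}),
    (0 < n)%N -> 0 < p < 1 -> q = 1 - p ->
    (forall i, has_law (B i) (bernoulli_law p)) ->
    mutually_independent B ->
    (forall i w, X i w = (B i w - p) / Num.sqrt (p * q)) ->
    (forall w, W w = (Num.sqrt n%:R)^-1 * \sum_(i < n) X i w) ->
    (L1dist (cdf W) (@Phi R)
       <= ((p ^+ 2 + q ^+ 2) / Num.sqrt (n%:R * p * q))%:E)%E /\
    (forall i : 'I_n,
       ((p ^+ 2 + q ^+ 2) / Num.sqrt (n%:R * p * q))%:E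
       = ('E_P[(fun w => `|X i w| ^+ 3)%R] * ((Num.sqrt n%:R)^-1)%:E)%E))
  /\
  (forall (d : measure_display) (T : measurableType d) (P : probability T R)
      (n : nat) (U : 'I_n -> {RV P >-> R}) (W : {RV P >-> R}),
    (0 < n)%N ->
    (forall i, has_law (U i) (uniform_prob (ltN_sqrt3 R))) ->
    mutually_independent U ->
    (forall w, W w = (Num.sqrt n%:R)^-1 * \sum_(i < n) U i w) ->
    (L1dist (cdf W) (@Phi R) <= (Num.sqrt 3 / (4 * Num.sqrt n%:R))%:E)%E /\
    (forall i : 'I_n,
       (Num.sqrt 3 / (4 * Num.sqrt n%:R))%:E
       = ('E_P[(fun w => `|U i w| ^+ 3)%R] * ((3 * Num.sqrt n%:R)^-1)%:E)%E))
  /\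
  (forall (d : measure_display) (T : measurableType d) (P : probability T R)
      (d' : measure_display) (T' : measurableType d') (P' : probability T' R)
      (s1 s2 : R) (X Z W : {RV P >-> R}) (Xs : {RV P' >-> R}),
    'E_P[X]%E = 0%E -> 'V_P[X] = (s1 ^+ 2)%:E ->
    has_law Z (gaussian_law 0 s2) ->
    independent2 X Z ->
    s1 ^+ 2 + s2 ^+ 2 = 1 ->
    (forall w, W w = X w + Z w) ->
    zero_biased X Xs ->
    (L1dist (cdf W) (@Phi R)
       <= (2 * s1 ^+ 2)%:E * L1dist (cdf Xs) (cdf X))%E).
Proof.
split; [|split].
- exact: binomial_L1dist.
- exact: uniform_sum_L1dist.
- exact: gaussian_sum_L1dist.
Qed.
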